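(* Suppose that the general assumptions (G1)--(G6) and the smoothness assumptions (S1)--(S3) listed in the context hold, that $\Xi$ is the support of $\mathbb{P}$, that $\beta\colon R\to[0,\infty)$ is convex, continuously differentiable, and satisfies $\beta(r)=0$ if and only if $r\in K$, and that $\mathcal{K}$ has nonempty interior. Let $(\gamma_N)\subset(0,\infty)$ satisfy $\gamma_N\to\infty$ as $N\to\infty$, and let $(u_N^{\gamma_N},\lambda_N^{\gamma_N})\subset U\times\mathcal{C}(\Xi;R)^*$ be a sequence satisfying, for each $N$, $$0\in D\widehat{F}_N(u_N^{\gamma_N})+\partial\psi(u_N^{\gamma_N})+D\mathcal{G}(u_N^{\gamma_N})^*\lambda_N^{\gamma_N},$$ where $\lambda_N^{\gamma_N}$ is defined by $$\langle\lambda_N^{\gamma_N},v\rangle:=\frac1N\sum_{i=1}^N\langle\gamma_N D\beta(G(u_N^{\gamma_N},\xi^i)),v(\xi^i)\rangle,\qquad v\in\mathcal{C}(\Xi;R).$$ Suppose that, w.p.1, $u_N^{\gamma_N}\rightharpoonup^*\bar u$, where $\bar u$ is such that there exists $\hat u\in\mathrm{dom}(\psi)$ with $$\mathcal{G}(\bar u)+D\mathcal{G}(\bar u)(\hat u-\bar u)\in\mathrm{int}(\mathcal{K}).$$ Then, w.p.1, weak$^*$ limits (along subsequences) of $(u_N^{\gamma_N},\lambda_N^{\gamma_N})$ are KKT points of problem (P).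
   Context: Probabilistic setting: $(\Omega,\mathcal{F},P)$ is a complete probability space; $\Xi$ is a complete separable metric space with its Borel $\sigma$-algebra; $\xi\colon\Omega\to\Xi$ is a random element whose law $\mathbb{P}$ is assumed complete; $\xi^1,\xi^2,\ldots$ are independent $\Xi$-valued random elements on $(\Omega,\mathcal{F},P)$, each with law $\mathbb{P}$; $\mathbb{E}$ denotes expectation. The support of $\mathbb{P}$ is the intersection of all closed sets of probability one. ''W.p.1'' means for $P$-a.e. $\omega\in\Omega$; dependence on $\omega$ is suppressed. General assumptions: (G1) $W$, $R$, $R_0$ are real separable Banach spaces with $R\subset R_0$, and $U$ is the dual of a real separable Banach space. (G2) $B\colon U\to W$ is linear and sequentially weakly$^*$-to-strongly continuous ($u_N\rightharpoonup^* u$ implies $Bu_N\to Bu$ in $W$). (G3) $\mathscr{J}\colon W\times\Xi\to[0,\infty)$ is random lower semicontinuous, i.e., $\xi\mapsto\{(w,t)\in W\times\mathbb{R}\mid \mathscr{J}(w,\xi)\le t\}$ is a random closed set (a measurable closed-valued multifunction). (G4) $\mathscr{G}\colon W\times\Xi\to R_0$ is Carath\'eodory (continuous in the first argument, measurable in the second), $\mathscr{G}(Bu,\xi)\in R$ for all $(u,\xi)\in U\times\Xi$, and $\mathscr{G}\colon B(\mathrm{dom}(\psi))\times\Xi\to R$ is Carath\'eodory. Moreover, $K\subset R$ is a nonempty, closed, convex cone. (G5) $\psi\colon U\to[0,\infty]$ is proper, convex, and sequentially weakly$^*$ lower semicontinuous, with a bounded, weakly$^*$ sequentially closed domain $\mathrm{dom}(\psi)=\{u\in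 U\mid\psi(u)<\infty\}$. (G6) Problem (P) below has a feasible point with finite objective function value. Smoothness assumptions: (S1) The metric space $\Xi$ is compact. (S2) $U_0\subset U$ and $W_0\subset W$ are open sets with $\mathrm{dom}(\psi)\subset U_0$ and $B(U_0)\subset W_0$. For all $\xi\in\Xi$, $\mathscr{J}(\cdot,\xi)$ is continuously differentiable on $W_0$, and for all $w\in W_0$, $D_w\mathscr{J}(w,\cdot)$ is measurable. Moreover, there is an integrable $L\colon\Xi\to[0,\infty)$ with $\|D_w\mathscr{J}(w,\xi)\|\le L(\xi)$ for all $(w,\xi)\in W_0\times\Xi$. (S3) For each $\xi\in\Xi$, $\mathscr{G}(\cdot,\xi)$ is continuously differentiable on $W_0$, and for all $w\in W_0$, $D_w\mathscr{G}(w,\cdot)$ is measurable. Moreover, $\mathscr{G}\colon B(U_0)\times\Xi\to R$ and $D_w\mathscr{G}\colon B(U_0)\times\Xi\to\mathscr{L}(W,R)$ (bounded linear operators from $W$ to $R$) are continuous. Notation: $J(u,\xi):=\mathscr{J}(Bu,\xi)$, $G(u,\xi):=\mathscr{G}(Bu,\xi)$, $F\colon U\to[0,\infty)$, $F(u):=\mathbb{E}[J(u,\xi)]$, $\widehat{F}_N(u):=\frac1N\sum_{i=1}^N J(u,\xi^i)$. $D$ denotes the Fr\'echet derivative and $\partial\psi$ the convex subdifferential. $\mathcal{C}(\Xi;R)$ is the space of continuous functions $\Xi\to R$ with the supremum norm; $\mathcal{G}\colon U_0\to\mathcal{C}(\Xi;R)$, $\mathcal{G}(u):=G(u,\cdot)$,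 is continuously differentiable with $D\mathcal{G}(u)=D_uG(u,\cdot)$ and adjoint $D\mathcal{G}(u)^*\colon\mathcal{C}(\Xi;R)^*\to U^*$. $\mathcal{K}:=\{r\in\mathcal{C}(\Xi;R)\mid r(\xi)\in K\ \text{for all}\ \xi\in\Xi\}$, and $\mathcal{K}^-:=\{\lambda\in\mathcal{C}(\Xi;R)^*\mid\langle\lambda,k\rangle\le0\ \text{for all}\ k\in\mathcal{K}\}$. Problem (P): $\min_{u\in U} F(u)+\psi(u)$ subject to $G(u,\xi)\in K$ for $\mathbb{P}$-a.e. $\xi\in\Xi$. A KKT point of (P) is a pair $(u,\lambda)\in U\times\mathcal{C}(\Xi;R)^*$ with $\mathcal{G}(u)\in\mathcal{K}$, $0\in DF(u)+\partial\psi(u)+D\mathcal{G}(u)^*\lambda$, $\lambda\in\mathcal{K}^-$, and $\langle\lambda,\mathcal{G}(u)\rangle=0$. *)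

(* Defs.v *)
From HB Require Import structures.
From mathcomp Require Import all_boot all_order all_algebra finmap.
From mathcomp Require Import all_classical all_reals all_analysis.

Set Implicit Arguments.
Unset Strict Implicit.
Unset Printing Implicit Defensive.

Import Order.TTheory GRing.Theory Num.Theory.
Import numFieldNormedType.Exports.

Local Open Scope classical_set_scope.
Local Open Scope ring_scope.

(** Complete metric spaces. They are pointed, hence nonempty, because the
    library's measurable types are. *)
#[short(type="completeMetricType")]
HB.structure Definition CompleteMetric (R : numDomainType) :=
  {T of CompletePseudoMetric R T & PseudoMetric_isMetric R T}.

Definition separable (T : topologicalType) : Prop :=
  exists2 S : set T, countable S & dense S.

Section BoundedLinear.
Context {R : realType} {V W : normedModType R}.

Definition blin_pred : {pred V -> W} :=
  fun f => `[< linear f /\ continuous f >].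

Record blin : Type := Blin { blin_fun :> V -> W; _ : blin_fun \in blin_pred }.

HB.instance Definition _ := [isSub of blin for blin_fun].
HB.instance Definition _ := [Choice of blin by <:].

Lemma blin_linear (f : blin) : linear f.
Proof. by have /asboolP[] := valP f. Qed.

Lemma blin_continuous (f : blin) : continuous f.
Proof. by have /asboolP[] := valP f. Qed.

HB.instance Definition _ (f : blin) :=
  GRing.isLinear.Build R V W *:%R f (@blin_linear f).

Lemma blin_submod_closed : submod_closed blin_pred.
Proof.
split.
  apply/asboolP; split; last by move=> x; exact: cvg_cst.
  by move=> a x y; rewrite /= scaler0 addr0.
move=> a f g /asboolP[lf cf] /asboolP[lg cg]; apply/asboolP; split.
  move=> b x y /=; rewrite !fctE lf lg !scalerDr !scalerA addrACA.
  by rewrite [a * b]mulrC.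
move=> x; apply: cvgD; last exact: cg.
by apply: cvgZl_tmp; exact: cf.
Qed.

HB.instance Definition _ :=
  GRing.isSubmodClosed.Build R (V -> W) blin_pred blin_submod_closed.
HB.instance Definition _ := [SubChoice_isSubLmodule of blin by <:].

Definition op_norm (f : blin) : R := sup [set `|f x| | x in [set x | `|x| <= 1]].

Lemma blin_ub (f : blin) : exists M, forall x, `|f x| <= M * `|x|.
Proof.
have /linear_boundedP : bounded_near (f : V -> W) (nbhs (0 : V)).
  by apply: continuous_linear_bounded; exact: blin_continuous.
by move=> /pinfty_ex_gt0[M M0 fM]; exists M.
Qed.

Lemma op_norm_has_sup (f : blin) :
  has_sup [set `|f x| | x in [set x | `|x| <= 1]].
Proof.
split; first by exists `|f 0|; exists 0 => //=; rewrite normr0.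
have [M fM] := blin_ub f; exists `|M| => _ [x /= x1 <-].
apply: (le_trans (fM x)); apply: (le_trans (ler_wpM2r _ (ler_norm M))) => //.
by rewrite ler_piMr.
Qed.

Lemma op_norm_ub (f : blin) x : `|x| <= 1 -> `|f x| <= op_norm f.
Proof. by move=> x1; apply: sup_upper_bound; [exact: op_norm_has_sup|exists x]. Qed.

Lemma op_norm_le (f : blin) M :
  (forall x, `|x| <= 1 -> `|f x| <= M) -> op_norm f <= M.
Proof.
move=> fM; apply: ge_sup; first by have [] := op_norm_has_sup f.
by move=> _ [x x1 <-]; exact: fM.
Qed.

Lemma op_norm_ge0 (f : blin) : 0 <= op_norm f.
Proof. by apply: le_trans (@op_norm_ub f 0 _); rewrite // normr0. Qed.

Lemma op_normD (f g : blin) : op_norm (f + g) <= op_norm f + op_norm g.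
Proof.
apply: op_norm_le => x x1; apply: (le_trans (ler_normD _ _)).
by apply: lerD; exact: op_norm_ub.
Qed.

Lemma op_normZ (l : R) (f : blin) : op_norm (l *: f) = `|l| * op_norm f.
Proof.
have le_normZ (k : R) (g : blin) : op_norm (k *: g) <= `|k| * op_norm g.
  apply: op_norm_le => x x1; rewrite [leLHS]normrZ.
  by apply: ler_wpM2l => //; exact: op_norm_ub.
apply/eqP; rewrite eq_le le_normZ /=.
have [->|l0] := eqVneq l 0; first by rewrite normr0 mul0r op_norm_ge0.
have := le_normZ l^-1 (l *: f); rewrite scalerA mulVf// scale1r normfV.
by rewrite ler_pdivlMl ?normr_gt0.
Qed.

Lemma op_norm0_eq0 (f : blin) : op_norm f = 0 -> f = 0.
Proof.
move=> f0; apply/val_inj/funext => x /=.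
have [->|x0] := eqVneq x 0; first by rewrite linear0.
have nx0 : `|x| != 0 by rewrite normr_eq0.
have : `|f (`|x|^-1 *: x)| <= op_norm f.
  by apply: op_norm_ub; rewrite normrZ normfV normr_id mulVf.
rewrite f0 normr_le0 linearZ/= scaler_eq0 invr_eq0 (negbTE nx0) /=.
by move=> /eqP.
Qed.

HB.instance Definition _ :=
  Lmodule_isNormed.Build R blin op_normD op_normZ op_norm0_eq0.

End BoundedLinear.
Arguments blin {R} V W.

Definition dual {R : realType} (V : normedModType R) := blin V R^o.

Section Adjoint.
Context {R : realType} {V W : normedModType R}.

Lemma adjoint_subproof (T : blin V W) (l : dual W) :
  (fun v => l (T v)) \in @blin_pred R V R^o.
Proof.
apply/asboolP; split; first by move=> a x y; rewrite !linearP.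
by move=> x; apply: continuous_comp; exact: blin_continuous.
Qed.

Definition adjoint (T : blin V W) (l : dual W) : dual V :=
  Blin (adjoint_subproof T l).

End Adjoint.

Section ContinuousFunctions.
Context {R : realType} {T : topologicalType} {W : normedModType R}.

Definition cont_pred : {pred T -> W} := fun f => `[< continuous f >].

Record cont (cT : compact [set: T]) : Type :=
  Cont { cont_fun :> T -> W; _ : cont_fun \in cont_pred }.

Context (cT : compact [set: T]).

HB.instance Definition _ := [isSub of cont cT for @cont_fun cT].
HB.instance Definition _ := [Choice of cont cT by <:].

Lemma cont_continuous (f : cont cT) : continuous f.
Proof. by have /asboolP := valP f. Qed.

Lemma cont_submod_closed : submod_closed cont_pred.
Proof.
split; first by apply/asboolP => x; exact: cvg_cst.
move=> a f g /asboolP cf /asboolP cg; apply/asboolP => x.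
by apply: cvgD; [apply: cvgZl_tmp; exact: cf|exact: cg].
Qed.

HB.instance Definition _ :=
  GRing.isSubmodClosed.Build R (T -> W) cont_pred cont_submod_closed.
HB.instance Definition _ := [SubChoice_isSubLmodule of cont cT by <:].

Definition sup_norm (f : cont cT) : R := sup [set `|f x| | x in [set: T]].

Lemma cont_ub (f : cont cT) : has_ubound [set `|f x| | x in [set: T]].
Proof.
have : compact (f @` [set: T]).
  apply: continuous_compact cT; apply: continuous_subspaceT.
  exact: cont_continuous.
move=> /compact_bounded /pinfty_ex_gt0[M M0 fM]; exists M => _ [x _ <-].
by apply: fM; exists x.
Qed.

Lemma sup_norm_ub (f : cont cT) x : `|f x| <= sup_norm f.
Proof. by apply: ub_le_sup; [exact: cont_ub|exists x]. Qed.

Lemma sup_norm_le (f : cont cT) M :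
  0 <= M -> (forall x, `|f x| <= M) -> sup_norm f <= M.
Proof.
move=> M0 fM; have [S0|/set0P/negP/negPn/eqP S0] :=
  pselect ([set `|f x| | x in [set: T]] !=set0).
  by apply: ge_sup => // _ [x _ <-].
by rewrite /sup_norm S0 sup0.
Qed.

Lemma sup_norm_ge0 (f : cont cT) : 0 <= sup_norm f.
Proof.
have [[x _]|T0] := pselect (exists _ : T, True).
  exact: le_trans (sup_norm_ub f x).
rewrite /sup_norm (_ : image _ _ = set0) ?sup0//.
by rewrite -subset0 => y [x _ _]; apply: T0; exists x.
Qed.

Lemma sup_normD (f g : cont cT) : sup_norm (f + g) <= sup_norm f + sup_norm g.
Proof.
apply: sup_norm_le => [|x]; first by rewrite addr_ge0 ?sup_norm_ge0.
by apply: (le_trans (ler_normD _ _)); apply: lerD; exact: sup_norm_ub.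
Qed.

Lemma sup_normZ (l : R) (f : cont cT) : sup_norm (l *: f) = `|l| * sup_norm f.
Proof.
have le_normZ (k : R) (g : cont cT) : sup_norm (k *: g) <= `|k| * sup_norm g.
  apply: sup_norm_le => [|x]; first by rewrite mulr_ge0 ?sup_norm_ge0.
  by rewrite [leLHS]normrZ; apply: ler_wpM2l => //; exact: sup_norm_ub.
apply/eqP; rewrite eq_le le_normZ /=.
have [->|l0] := eqVneq l 0; first by rewrite normr0 mul0r sup_norm_ge0.
have := le_normZ l^-1 (l *: f); rewrite scalerA mulVf// scale1r normfV.
by rewrite ler_pdivlMl ?normr_gt0.
Qed.

Lemma sup_norm0_eq0 (f : cont cT) : sup_norm f = 0 -> f = 0.
Proof.
move=> f0; apply/val_inj/funext => x /=.
by apply/eqP; rewrite -normr_le0 -f0; exact: sup_norm_ub.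
Qed.

HB.instance Definition _ :=
  Lmodule_isNormed.Build R (cont cT) sup_normD sup_normZ sup_norm0_eq0.

End ContinuousFunctions.
Arguments cont {R T} W cT.

(** [to_cont cT f] is [f] if [f] is continuous; the value [0] otherwise is
    irrelevant. *)
Definition to_cont {R : realType} {T : topologicalType} {W : normedModType R}
  (cT : compact [set: T]) (f : T -> W) : cont W cT := insubd 0 f.
Arguments to_cont {R T W} cT f.

(** ['d f x] as an element of the space of bounded linear operators; the default
    [0] of [insubd] is never used where [f] is differentiable, since then
    ['d f x] is continuous. *)
Definition fderiv {R : realType} {V W : normedModType R} (f : V -> W) (x : V) :
  blin V W := insubd 0 ('d f x : V -> W).

(** [A] is meant to be open: continuity is that of [fderiv f] at the points of
    [A], not of its restriction to [A]. *)
Definition C1_on {R : realType} {V W : normedModType R} (A : set V)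
    (f : V -> W) : Prop :=
  {in A, forall x, differentiable f x} /\ {in A, continuous (fderiv f)}.

Section ConvexAnalysis.
Context {R : realType}.

Definition weakstar_cvg {X : normedModType R} (u_ : nat -> dual X)
    (u : dual X) : Prop :=
  forall x : X, (u_ n x : R) @[n --> \oo] --> (u x : R).

Definition edom {V : Type} (psi : V -> \bar R) : set V :=
  [set u | (psi u < +oo)%E].

Definition convex_ereal {V : lmodType R} (psi : V -> \bar R) : Prop :=
  forall (u v : V) (t : R), 0 <= t <= 1 ->
    (psi (t *: u + (1 - t) *: v)%R <= t%:E * psi u + (1 - t)%R%:E * psi v)%E.

Definition subdiff {V : normedModType R} (psi : V -> \bar R) (u : V) :
  set (dual V) :=
  [set eta | psi u \is a fin_num /\
    forall v, (psi u + (eta (v - u)%R)%:E <= psi v)%E].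

Definition cone {V : lmodType R} (K : set V) : Prop :=
  forall (t : R) (k : V), 0 < t -> K k -> K (t *: k).

Definition pointwise_cone {T : topologicalType} {Y : normedModType R}
    (cT : compact [set: T]) (K : set Y) : set (cont Y cT) :=
  [set r | forall x, K (r x)].

Definition polar {V : normedModType R} (K : set V) : set (dual V) :=
  [set l | forall k, K k -> l k <= 0].

(** [0 \in DF(u) + \partial psi(u) + DG(u)^* lambda] in [dual V]. *)
Definition stationary {V Z : normedModType R} (F : V -> R^o)
    (psi : V -> \bar R) (G : V -> Z) (u : V) (l : dual Z) : Prop :=
  exists2 eta, subdiff psi u eta &
    fderiv F u + eta + adjoint (fderiv G u) l = 0.

Definition KKT_point {V Z : normedModType R} (F : V -> R^o)
    (psi : V -> \bar R) (G : V -> Z) (K : set Z) (u : V) (l : dual Z) : Prop :=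
  [/\ differentiable F u /\ differentiable G u,
      K (G u),
      stationary F psi G u l,
      polar K l &
      l (G u) = 0].

End ConvexAnalysis.
Arguments pointwise_cone {R T Y} cT K.

Definition borel (T : ptopologicalType) := g_sigma_algebraType (@open T).

Section Probability.
Context {R : realType}.

(** The completion of the sigma-algebra of [T] with respect to [mu]. *)
Definition completed_measurable d (T : measurableType d)
    (mu : {measure set T -> \bar R}) : set (set T) :=
  [set A | exists2 B, measurable B & mu.-negligible ((A `\` B) `|` (B `\` A))].

Definition completion d (T : measurableType d)
    (mu : {measure set T -> \bar R}) :=
  g_sigma_algebraType (completed_measurable mu).

Definition law d (Omega : measurableType d) (Xi : ptopologicalType)
    (P : probability Omega R) (X : {mfun Omega >-> borel Xi}) :
  probability (borel Xi) R := distribution P X.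

(** Measurability with respect to the completed Borel sigma-algebra. A law that
    is already complete on [borel Xi] exists only when [Xi] is countable. *)
Definition law_measurable {Xi T : ptopologicalType}
    (mu : probability (borel Xi) R) (f : Xi -> T) : Prop :=
  measurable_fun [set: completion mu] (f : completion mu -> borel T).

(** Measurability of the multifunction [S] is that of [{xi | S xi meets O}] for
    all open [O]. *)
Definition random_closed {Xi : ptopologicalType} {T : topologicalType}
    (mu : probability (borel Xi) R) (S : Xi -> set T) : Prop :=
  (forall xi, closed (S xi)) /\
  (forall O : set T, open O ->
    measurable ([set xi | S xi `&` O !=set0] : set (completion mu))).

Definition random_lsc {Xi : ptopologicalType} {W : normedModType R}
    (mu : probability (borel Xi) R) (J : W -> Xi -> R) : Prop :=
  random_closed mu (fun xi => [set p : W * R | J p.1 xi <= p.2]).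

Definition caratheodory_on {Xi T Z : ptopologicalType}
    (mu : probability (borel Xi) R) (A : set T) (f : T -> Xi -> Z) : Prop :=
  (forall xi, {within A, continuous (f ^~ xi)}) /\
  (forall w, A w -> law_measurable mu (f w)).

Definition law_support {T : ptopologicalType} (mu : probability (borel T) R) :
  set T := \bigcap_(A in [set A | closed A /\ mu A = 1%E]) A.

Definition independent_sequence d d' (Omega : measurableType d)
    (T : measurableType d') (P : probability Omega R) (X : nat -> Omega -> T) :
  Prop :=
  forall (I : {fset nat}) (A : nat -> set T), (forall i, measurable (A i)) ->
    P (\bigcap_(i in [set` I]) (X i @^-1` A i)) =
      (\prod_(i <- I) P (X i @^-1` A i))%E.

End Probability.

Section Problem.
Context {R : realType}.

(** For an injection [iota : Y -> Y0], the preimage of a point in its range;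
    [0] outside. *)
Definition preim_of {Y Y0 : lmodType R} (iota : Y -> Y0) (y0 : Y0) : Y :=
  xget 0 [set y | iota y = y0].

Definition expected_cost d (Omega : measurableType d) (P : probability Omega R)
    (Xi V W : Type) (xi : Omega -> Xi) (B : V -> W) (J : W -> Xi -> R) (u : V) :
  \bar R := 'E_P[fun w => J (B u) (xi w)].

(** [G0 : W -> Xi -> Y0] regarded as [Y]-valued. *)
Definition constraint {Xi W : Type} {Y Y0 : lmodType R} (iota : Y -> Y0)
    (G0 : W -> Xi -> Y0) (w : W) (xi : Xi) : Y := preim_of iota (G0 w xi).

(** [u |-> G(u, .)] with values in the space of continuous functions. *)
Definition constraint_map {Xi : topologicalType} {V W : Type}
    {Y : normedModType R} {Y0 : lmodType R} (cXi : compact [set: Xi])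
    (B : V -> W) (iota : Y -> Y0) (G0 : W -> Xi -> Y0) (u : V) : cont Y cXi :=
  to_cont cXi (constraint iota G0 (B u)).

(** The sample [xi^1, ..., xi^N] is [x 0, ..., x (N - 1)]. *)
Definition sample_cost {Xi V W : Type} (x : nat -> Xi) (B : V -> W)
    (J : W -> Xi -> R) (N : nat) (u : V) : R^o :=
  N%:R^-1 * \sum_(i < N) J (B u) (x i).

End Problem.
Arguments constraint_map {R Xi V W Y Y0} cXi B iota G0 u.

(* Main.v *)
Require Import Defs.
From HB Require Import structures.
From mathcomp Require Import all_boot all_order all_algebra finmap.
From mathcomp Require Import all_classical all_reals all_analysis.
From mathcomp Require Import measurable_realfun.
From mathcomp Require Import ring lra.

(** Fix a sample path outside a suitable null set, and a subsequence along which
    the primal points and the multipliers converge weakly-star to [u] and [l].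
    As [B] is weakly-star-to-strongly continuous, [B] of the primal points
    converges in norm; this makes the constraint and the directional derivatives
    converge strongly ([constraint_map_cvg], [constraint_deriv_cvg]).

    Convexity of the penalty [beta], which vanishes exactly on the cone [K], shows
    that its derivative at [r] is nonpositive on [K] and at least [beta r] in the
    direction [r] ([penalty_deriv_le0], [penalty_deriv_ge]). Hence the multipliers
    lie in the polar cone, and their pairing with the constraint is at least
    [gamma] times the average of [beta] over the sample, in particular
    nonnegative. Testing stationarity in the Slater direction bounds the
    multipliers from below at points that converge to an interior point of the
    cone, and therefore bounds their norms ([stationary_multipliers_bounded]).
    Pairings of multipliers with strongly convergent arguments then converge, and
    the variational inequality that expresses stationarity passes to the limit
    ([stationary_limit]). Complementarity holds since the limit pairing is both
    nonpositive and nonnegative.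

    For feasibility, the bounded pairings and [gamma] tending to infinity force
    the averages of [beta] over the sample to zero. Every neighborhood of every
    point of the compact space is hit with positive frequency
    ([empirical_frequency]), as the law has full support, so the limit constraint
    cannot leave [K] anywhere ([penalized_limit_feasible]).

    What probability has to provide is that the derivatives of the empirical
    costs, at points which depend on the sample, converge to the derivative of the
    expected cost ([empirical_deriv_cvg]). This uniform law of large numbers
    follows from the strong law for countably many upper envelopes of the
    derivative over small balls with centers in a dense sequence; separability,
    continuity of the derivative and the integrable bound [L] make them
    sufficient. The strong law itself ([strong_law]) is proved by Etemadi's method
    of truncation along geometrically growing blocks.

    The other analytic point is that the constraint is differentiable as a map
    into continuous functions with values in the small space [Y], although it is
    pointwise differentiable only into the large space [Y0]: the Riemann sums of
    the candidate derivative, which is continuous into [Y], converge in [Y] to the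
    increment ([increment_in_subspace], [constraint_map_deriv]). *)

Set Implicit Arguments.
Unset Strict Implicit.
Unset Printing Implicit Defensive.

Import Order.TTheory GRing.Theory Num.Theory.
Import numFieldNormedType.Exports.

Local Open Scope classical_set_scope.
Local Open Scope ring_scope.

(** * The strong law of large numbers *)

Section StrongLaw.
Context d (T : measurableType d) (R : realType) (P : probability T R).
Local Open Scope ereal_scope.

Lemma borel_cantelli_ae (F : (set T)^nat) : (forall n, measurable (F n)) ->
  \sum_(n <oo) P (F n) < +oo -> {ae P, forall w, \forall n \near \oo, ~ F n w}.
Proof.
move=> mF PF; exists (lim_sup_set F); split.
- apply: bigcapT_measurable => n; apply: bigcup_measurable => k _; exact: mF.
- exact: lim_sup_set_cvg0.
- move=> w /= nw n _; apply: contrapT => nF; apply: nw; exists n => // k /= nk.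
  by move=> Fk; apply: nF; exists k.
Qed.

Lemma bounded_Lfun2 (f : T -> R) (M : R) : measurable_fun setT f ->
  (forall x, `|f x| <= M)%R -> f \in Lfun P 2%:E.
Proof.
move=> mf fM; rewrite inE/=; apply/andP; split; rewrite inE//=.
rewrite /finite_norm unlock poweR_lty//.
apply: (@le_lt_trans _ _ (\int[P]_x (cst (M `^ 2)%:E x))).
  apply: ge0_le_integral => //=.
  - apply/measurable_EFinP; apply: (measurableT_comp (measurable_powR _)) => //.
    exact: measurableT_comp.
  - move=> x _; rewrite lee_fin ge0_ler_powR// nnegrE//.
    exact: le_trans (fM x).
by rewrite integral_cst//= probability_setT mule1 ltry.
Qed.

Definition independent_pair (X Y : T -> R) := forall A B : set R,
  measurable A -> measurable B ->
  P (X @^-1` A `&` Y @^-1` B) = P (X @^-1` A) * P (Y @^-1` B).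

(** By uniqueness of product measures the joint law is the product of the two
    laws, and Tonelli applies. *)
Lemma independent_expectationM (X Y : {RV P >-> R}) : independent_pair X Y ->
  (forall w, 0 <= X w)%R -> (forall w, 0 <= Y w)%R ->
  'E_P[X \* Y]%R = 'E_P[X] * 'E_P[Y].
Proof.
move=> XY X0 Y0.
pose p (w : T) := (X w, Y w).
have mp : measurable_fun setT p by apply: measurable_fun_pair.
pose p' : {mfun T >-> (R * R)%type} := mfun_Sub (mem_set mp).
have E : forall S, measurable S ->
    (distribution P X \x distribution P Y) S = distribution P p' S.
  apply: product_measure_unique => A B mA mB.
  exact: XY.
pose f (z : R * R) : \bar R := (`|z.1| * `|z.2|)%:E.
have mf : measurable_fun setT f.
  apply/measurable_EFinP; apply: measurable_funM.
    by apply: measurableT_comp => //; exact: measurable_fst.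
  by apply: measurableT_comp => //; exact: measurable_snd.
have -> : 'E_P[X \* Y] = \int[distribution P p']_z f z.
  rewrite ge0_integral_distribution//; first by rewrite unlock; apply: eq_integral => w _; rewrite /= /f/= !ger0_norm.
  by move=> z; rewrite /f lee_fin mulr_ge0.
have <- : \int[distribution P X \x distribution P Y]_z f z =
    \int[distribution P p']_z f z.
  by apply: eq_measure_integral => A mA _; exact: E.
rewrite fubini_tonelli1//; last by move=> z; rewrite /f lee_fin mulr_ge0.
have -> : 'E_P[Y] = \int[distribution P Y]_y `|y|%:E.
  rewrite ge0_integral_distribution//; first by rewrite unlock; apply: eq_integral => w _; rewrite /= ger0_norm.
  by apply/measurable_EFinP.
have -> : 'E_P[X] = \int[distribution P X]_y `|y|%:E.
  rewrite ge0_integral_distribution//; first by rewrite unlock; apply: eq_integral => w _; rewrite /= ger0_norm.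
  by apply/measurable_EFinP.
rewrite /fubini_F -ge0_integralZr//=; last 2 first.
  by apply/measurable_EFinP.
  by apply: integral_ge0 => y _; rewrite lee_fin.
apply: eq_integral => x _; rewrite /f /=.
under eq_integral do rewrite EFinM.
rewrite ge0_integralZl//.
by apply/measurable_EFinP.
Qed.

(** Independence enters only through the vanishing of the covariances, so that
    pairwise independence suffices. *)
Lemma variance_sum (X : {RV P >-> R}^nat) (M V : R) N :
  (forall i w, 0 <= X i w <= M)%R ->
  (forall i j, i != j -> independent_pair (X i) (X j)) ->
  (forall i, 'E_P[(X i : T -> R) ^+ 2]%R <= V%:E) ->
  'V_P[\sum_(i < N) (X i : T -> R)]%R <= (N%:R * V)%:E.
Proof.
move=> X0M ind XV.
have XL i : (X i : T -> R) \in Lfun P 2%:E.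
  by apply: (@bounded_Lfun2 _ M) => // x; have /andP[? ?] := X0M i x; rewrite ger0_norm.
have SL n : (\sum_(i < n) (X i : T -> R))%R \in Lfun P 2%:E.
  by rewrite rpred_sum ?lee1n.
have Pfin : P setT \is a fin_num := fin_num_measure P _ measurableT.
have cov i j : i != j -> covariance P (X i) (X j) = 0.
  move=> ij; rewrite covarianceE ?Lfun2_mul_Lfun1 ?(Lfun_subset12 Pfin)//.
  rewrite independent_expectationM; last 3 first.
  - exact: ind.
  - by move=> w; have /andP[] := X0M i w.
  - by move=> w; have /andP[] := X0M j w.
  by rewrite subee// fin_numM// expectation_fin_num// (Lfun_subset12 Pfin).
have covS n j : (n <= j)%N -> covariance P (\sum_(i < n) (X i : T -> R))%R (X j) = 0.
  elim: n => [|n IH] nj.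
    by rewrite big_ord0 (covariance_cst_l P 0).
  rewrite big_ord_recr/= covarianceDl//; last exact: SL.
  rewrite IH 1?ltnW// cov ?adde0//.
  by rewrite neq_ltn nj.
have VX i : 'V_P[X i] <= V%:E.
  rewrite varianceE//; apply: le_trans (XV i).
  rewrite geeDl// oppe_le0; apply: expe_ge0.
  by rewrite expectation_ge0// => w; have /andP[] := X0M i w.
elim: N => [|N IH].
  by rewrite big_ord0 (variance_cst P 0) mul0r.
rewrite big_ord_recr/= varianceD//; last exact: SL.
rewrite covS// mule0 adde0.
by rewrite -natr1 mulrDl mul1r EFinD leeD.
Qed.

Lemma sume_const n (x : \bar R) : \sum_(i < n) x = n%:R%:E * x.
Proof.
elim: n => [|n IH]; first by rewrite big_ord0 mul0e.
by rewrite big_ord_recr/= IH -natr1 EFinD ge0_muleDl ?mul1e.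
Qed.

Lemma expectationE (X : T -> R) : 'E_P[X] = \int[P]_w (X w)%:E.
Proof. by rewrite unlock. Qed.

Definition same_law (X Y : T -> R) :=
  forall A : set R, measurable A -> P (X @^-1` A) = P (Y @^-1` A).

Lemma independent_pair_comp (X Y : T -> R) (f g : R -> R) :
  measurable_fun setT f -> measurable_fun setT g ->
  independent_pair X Y -> independent_pair (f \o X) (g \o Y).
Proof.
move=> mf mg XY A B mA mB; apply: (XY (f @^-1` A) (g @^-1` B)).
  by rewrite -[X in measurable X]setTI; exact: mf.
by rewrite -[X in measurable X]setTI; exact: mg.
Qed.

Lemma same_law_expectation (X Y : {RV P >-> R}) (f : R -> R) :
  measurable_fun setT f -> (forall x, 0 <= f x)%R -> same_law X Y ->
  'E_P[f \o X] = 'E_P[f \o Y].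
Proof.
move=> mf f0 XY; rewrite unlock.
have mf' : measurable_fun setT (EFin \o f) by apply/measurable_EFinP.
rewrite -(@ge0_integral_distribution _ _ _ _ _ P X (EFin \o f))//.
rewrite -(@ge0_integral_distribution _ _ _ _ _ P Y (EFin \o f))//.
by apply: eq_measure_integral => A mA _; exact: XY.
Qed.

(** A pointwise linear bound on a series of nonnegative functions of [X] is
    integrated term by term; it serves for both series of probabilities in the
    law of large numbers. *)
Lemma series_expectation_lty (X : {RV P >-> R}) (f : nat -> R -> R) (c : R) :
  (forall w, 0 <= X w)%R -> 'E_P[X] < +oo ->
  (forall n, measurable_fun setT (f n)) -> (forall n x, 0 <= f n x)%R ->
  (forall m x, 0 <= x -> \sum_(n < m) f n x <= c * x)%R ->
  \sum_(n <oo) 'E_P[f n \o X] < +oo.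
Proof.
move=> X0 EX mf f0 fc.
have c0 : (0 <= c)%R.
  have := fc 0%N 1%R ler01; by rewrite big_ord0 mulr1.
apply: (@le_lt_trans _ _ (c%:E * 'E_P[X])); last first.
  by rewrite lte_mul_pinfty.
apply: lime_le.
  by apply: is_cvg_nneseries => n _ _; apply: expectation_ge0 => w; exact: f0.
apply: nearW => m; rewrite big_mkord expectationE -ge0_integralZl//; last 2 first.
  by apply/measurable_EFinP.
  by move=> x _; rewrite lee_fin.
under eq_bigr do rewrite expectationE.
rewrite -(big_mkord xpredT (fun n => \int[P]_w ((f n \o X) w)%:E)).
rewrite -ge0_integral_sum//; last 2 first.
  by move=> n; apply/measurable_EFinP; exact: measurableT_comp.
  by move=> n x _; rewrite lee_fin; exact: f0.
apply: ge0_le_integral => //.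
- by move=> x _; apply: sume_ge0 => n _; rewrite lee_fin; exact: f0.
- apply: emeasurable_sum => n.
  by apply/measurable_EFinP; exact: measurableT_comp.
- apply/measurable_EFinP; exact: measurable_funM.
- move=> x _; rewrite big_mkord sumEFin lee_fin; exact: fc.
Qed.

Definition truncation (n : nat) (x : R) : R := (x * (x <= 2 ^+ n)%R%:R)%R.

Lemma measurable_truncation n : measurable_fun setT (truncation n).
Proof.
apply: measurable_funM => //.
rewrite (_ : (fun _ => _) = \1_[set x | x <= 2 ^+ n]%R); last first.
  by apply/funext => x; rewrite indicE mem_setE.
apply: measurable_indic; rewrite (_ : mkset _ = `]-oo, (2 ^+ n)%R]%classic)//.
Qed.

Lemma truncation_bound n x : (0 <= x -> 0 <= truncation n x <= 2 ^+ n)%R.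
Proof.
move=> x0; rewrite /truncation; case: (leP x (2 ^+ n)%R) => xn /=.
  by rewrite mulr1 x0.
by rewrite mulr0 lexx exprn_ge0.
Qed.

(** The levels [2 ^ n] that a point exceeds form a geometric progression, which
    its last term dominates; this makes the large values summable. *)
Lemma sum_levels_below m (x : R) : (0 <= x ->
  \sum_(n < m) 2 ^+ n * (2 ^+ n < x)%R%:R <= 2 * x)%R.
Proof.
move=> x0.
have H k : (\sum_(n < k) 2 ^+ n * (2 ^+ n < x)%R%:R <= 2 ^+ k :> R)%R.
  elim: k => [|k IH]; first by rewrite big_ord0 exprn_ge0.
  rewrite big_ord_recr/= exprS mulr_natl mulr2n lerD//.
  by rewrite ler_piMr ?exprn_ge0// lern1 leq_b1.
elim: m => [|m IH]; first by rewrite big_ord0 mulr_ge0.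
rewrite big_ord_recr/=; case: (ltP (2 ^+ m)%R x) => xm; last first.
  by rewrite mulr0 addr0.
rewrite mulr1 mulr_natl mulr2n lerD//; last exact: ltW.
exact: le_trans (H m) (ltW xm).
Qed.

(** Dually, the levels that are not exceeded contribute a convergent geometric
    series to the second moments of the truncations. *)
Lemma sum_levels_above m (x : R) : (0 <= x ->
  \sum_(n < m) 2 ^- n * truncation n x ^+ 2 <= 2 * x)%R.
Proof.
move=> x0.
have p0 n : (0 < 2 ^+ n :> R)%R by rewrite exprn_gt0.
have sq n : (2 ^- n * truncation n x ^+ 2 = 2 ^- n * x ^+ 2 * (x <= 2 ^+ n)%R%:R)%R.
  by rewrite /truncation exprMn -mulrA; case: (x <= _)%R; rewrite ?expr1n// expr0n.
(* once the level exceeds [x], the remaining tail of the series is exactly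
   [2 * x ^+ 2 * 2 ^- m], which makes the bound inductive *)
have : (if x <= 2 ^+ m then
    \sum_(n < m) 2 ^- n * truncation n x ^+ 2 <= 2 * x - 2 * x ^+ 2 * 2 ^- m
  else \sum_(n < m) 2 ^- n * truncation n x ^+ 2 == 0)%R.
  elim: m => [|m IH].
    rewrite !big_ord0 expr0 invr1 mulr1; case: leP => // x1.
    by rewrite subr_ge0 ler_pM2l// expr2 ler_piMr.
  rewrite big_ord_recr/= sq; move: IH; case: (leP x (2 ^+ m)%R) => xm IH.
    have -> : (x <= 2 ^+ m.+1)%R.
      by apply: (le_trans xm); rewrite ler_eXn2l// ltr1n.
    rewrite mulr1; apply: (le_trans (lerD IH (lexx _))).
    have := p0 m; rewrite (exprS _ m); set e := (2 ^+ m)%R => e0.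
    by rewrite le_eqVlt; apply/orP; left; apply/eqP; field; rewrite gt_eqF.
  rewrite mulr0 addr0 (eqP IH) eqxx; case: ifP => // xm'.
  rewrite subr_ge0 -ler_pdivlMr ?invr_gt0// invrK -mulrA ler_pM2l// expr2.
  by rewrite ler_wpM2l.
case: ifP => [_|_ /eqP->]; last by rewrite mulr_ge0.
move=> /le_trans; apply; rewrite gerBl.
by rewrite mulr_ge0 ?invr_ge0 ?(ltW (p0 _))// mulr_ge0 ?exprn_ge0.
Qed.

(** Along the blocks of length [j * 2 ^ n], with values truncated at [2 ^ n],
    both exceptional sets of the law of large numbers have summable
    probabilities, by [sum_levels_below] and [sum_levels_above]. *)
Section Blocks.
Context (Z : {RV P >-> R}^nat) (j : nat).
Hypotheses (j0 : (0 < j)%N) (Z0 : forall i w, (0 <= Z i w)%R).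
Hypotheses (EZ : 'E_P[Z 0%N] < +oo).
Hypotheses (law : forall i, same_law (Z i) (Z 0%N)).
Hypotheses (ind : forall i k, i != k -> independent_pair (Z i) (Z k)).

Let N n := (j * 2 ^ n)%N.

Let N_gt0 n : (0 < (N n)%:R :> R)%R.
Proof. by rewrite ltr0n muln_gt0 j0 expn_gt0. Qed.

Let NE n : ((N n)%:R = j%:R * 2 ^+ n :> R)%R.
Proof. by rewrite natrM natrX. Qed.

Lemma blocks_eventually_small : {ae P, forall w, \forall n \near \oo,
  forall i, (i < N n)%N -> (Z i w <= 2 ^+ n)%R}.
Proof.
have mgt n : measurable [set x : R | 2 ^+ n < x]%R.
  by rewrite (_ : mkset _ = `](2 ^+ n)%R, +oo[%classic)// set_itvE.
have mpre n i : measurable (Z i @^-1` [set x | 2 ^+ n < x]%R).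
  by rewrite -[X in measurable X]setTI; exact: measurable_funPT.
suff : {ae P, forall w, \forall n \near \oo,
    ~ (\bigcup_(i < N n) (Z i @^-1` [set x | 2 ^+ n < x]%R)) w}.
  apply: filterS => w; apply: filterS => n nA i iN.
  by rewrite leNgt; apply/negP => Zi; apply: nA; exists i.
apply: borel_cantelli_ae => [n|].
  by apply: bigcup_measurable => i _.
pose f n (x : R) : R := (2 ^+ n * (2 ^+ n < x)%R%:R)%R.
have mf n : measurable_fun setT (f n).
  apply: measurable_funM => //.
  rewrite (_ : (fun _ => _) = \1_[set x | 2 ^+ n < x]%R); last first.
    by apply/funext => x; rewrite indicE mem_setE.
  exact: measurable_indic.
have f0 n x : (0 <= f n x)%R by rewrite mulr_ge0.
have := @series_expectation_lty (Z 0%N) f 2 (Z0 0%N) EZ mf f0 sum_levels_below.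
move=> H; apply: (@le_lt_trans _ _ (j%:R%:E * \sum_(n <oo) 'E_P[f n \o Z 0%N])).
  rewrite -nneseriesZl; last by move=> n _; apply: expectation_ge0 => w; exact: f0.
  apply: lee_nneseries => n _ //.
  apply: (@le_trans _ _ (\sum_(i < N n) P (Z i @^-1` [set x | 2 ^+ n < x]%R))).
    have := Boole_inequality P (fun i (_ : (i < N n)%N) => mpre n i).
    by rewrite [X in _ -> P X <= _](bigcup_mkord (N n) (fun i => Z i @^-1` [set x | 2 ^+ n < x]%R)).
  rewrite (eq_bigr (fun=> P (Z 0%N @^-1` [set x | 2 ^+ n < x]%R))); last first.
    by move=> i _; apply: law.
  rewrite sume_const.
  have -> : 'E_P[f n \o Z 0%N] = (2 ^+ n)%:E * P (Z 0%N @^-1` [set x | 2 ^+ n < x]%R).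
    rewrite -expectation_indic// !expectationE -ge0_integralZl//; last first.
      by apply/measurable_EFinP; apply: measurable_indic.
    apply: eq_integral => w _; rewrite /f/= indicE EFinM; congr (_ * (_%:R)%:E).
    by rewrite mem_setE.
  by rewrite muleA -EFinM -NE.
by rewrite lte_mul_pinfty.
Qed.

Let mY n i := measurableT_comp (measurable_truncation n)
  (measurable_funPT (Z i)).
Let Y n i : {RV P >-> R} := mfun_Sub (mem_set (mY n i)).

Let Y0 n i w : (0 <= Y n i w <= 2 ^+ n)%R.
Proof. exact: truncation_bound. Qed.

Let EY n i : 'E_P[Y n i] = 'E_P[Y n 0%N].
Proof.
have E k : 'E_P[Y n k] = 'E_P[(fun x => `|truncation n x|)%R \o Z k].
  rewrite !expectationE; apply: eq_integral => w _ /=.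
  by rewrite ger0_norm//; have /andP[] := Y0 n k w.
rewrite !E; apply: same_law_expectation => //.
by apply: measurableT_comp => //; exact: measurable_truncation.
Qed.

Let EY2 n i : 'E_P[(Y n i : T -> R) ^+ 2]%R = 'E_P[(Y n 0%N : T -> R) ^+ 2]%R.
Proof.
apply: (@same_law_expectation (Z i) (Z 0%N) (fun x => truncation n x ^+ 2)%R) => //.
  by apply: measurable_funX; exact: measurable_truncation.
by move=> x; exact: sqr_ge0.
Qed.

Let YL2 n i : (Y n i : T -> R) \in Lfun P 2%:E.
Proof.
apply: (@bounded_Lfun2 _ (2 ^+ n)%R) => // w.
by have /andP[? ?] := Y0 n i w; rewrite ger0_norm.
Qed.

Let YL1 n i : (Y n i : T -> R) \in Lfun P 1.
Proof. have Pfin : P setT \is a fin_num := fin_num_measure P _ measurableT.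
exact: (Lfun_subset12 Pfin (YL2 n i)). Qed.

(** Chebyshev's inequality and the first Borel-Cantelli lemma: relative to the
    squared length of the block, the variance of the truncated sum is at most a
    constant times the expectation of a term of the series in
    [sum_levels_above]. *)
Lemma truncated_blocks_deviation (k : nat) : {ae P, forall w,
  \forall n \near \oo, (`|\sum_(i < N n) truncation n (Z i w) -
    (N n)%:R * fine 'E_P[truncation n \o Z 0%N]| < k.+1%:R^-1 * (N n)%:R)%R}.
Proof.
have mS n : measurable_fun setT (\sum_(i < N n) (Y n i : T -> R))%R.
  rewrite (_ : (\sum_(i < N n) (Y n i : T -> R))%R =
    fun w => (\sum_(i < N n) Y n i w)%R); last first.
    by apply/funext => w; rewrite fct_sumE.
  by apply: measurable_sum => i.
pose S n : {RV P >-> R} := mfun_Sub (mem_set (mS n)).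
have SE n w : S n w = (\sum_(i < N n) Y n i w)%R.
  by rewrite /S/= fct_sumE.
have ES n : fine 'E_P[S n] = ((N n)%:R * fine 'E_P[Y n 0%N])%R.
  have -> : 'E_P[S n] = \sum_(i < N n) 'E_P[Y n i].
    rewrite /S/= -(big_map (fun i : 'I__ => Y n i : T -> R) xpredT id).
    rewrite expectation_sum ?big_map// => X /mapP[i _ ->].
    exact: YL1.
  rewrite (eq_bigr (fun=> 'E_P[Y n 0%N])) => [|i _]; last exact: EY.
  have EYfin : 'E_P[Y n 0%N] \is a fin_num by exact: expectation_fin_num.
  by rewrite sume_const// fineM.
pose V n := fine 'E_P[(Y n 0%N : T -> R) ^+ 2]%R.
have VE n : 'E_P[(Y n 0%N : T -> R) ^+ 2]%R = (V n)%:E.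
  by rewrite fineK// expectation_fin_num//; exact: Lfun2_mul_Lfun1.
pose F n := [set w | k.+1%:R^-1 * (N n)%:R <= `|S n w - fine 'E_P[S n]|]%R.
suff : {ae P, forall w, \forall n \near \oo, ~ F n w}.
  apply: filterS => w; apply: filterS => n /negP; rewrite -ltNge.
  by rewrite SE ES.
have e0 n : (0 < k.+1%:R^-1 * (N n)%:R :> R)%R by rewrite mulr_gt0// invr_gt0.
apply: borel_cantelli_ae => [n|].
  rewrite /F -[X in measurable X]setTI.
  rewrite (_ : (fun _ => _) = (fun w => `|S n w - fine 'E_P[S n]|) @^-1`
    `[(k.+1%:R^-1 * (N n)%:R)%R, +oo[)%R; last first.
    by apply/funext => w /=; rewrite in_itv/= andbT.
  have mD : measurable_fun setT (fun w => `|S n w - fine 'E_P[S n]|)%R.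
    by apply: measurableT_comp => //; exact: measurable_funB.
  exact: mD.
pose g n (x : R) : R := (2 ^- n * truncation n x ^+ 2)%R.
have mg n : measurable_fun setT (g n).
  by apply: measurable_funM => //; apply: measurable_funX; exact: measurable_truncation.
have g0 n x : (0 <= g n x)%R by rewrite mulr_ge0 ?sqr_ge0 ?invr_ge0 ?exprn_ge0.
have := @series_expectation_lty (Z 0%N) g 2 (Z0 0%N) EZ mg g0 sum_levels_above.
move=> H; pose C : R := (k.+1%:R ^+ 2 / j%:R)%R.
have C0 : (0 <= C)%R by rewrite divr_ge0.
apply: (@le_lt_trans _ _ (C%:E * \sum_(n <oo) 'E_P[g n \o Z 0%N])).
  rewrite -nneseriesZl; last by move=> n _; apply: expectation_ge0 => w; exact: g0.
  apply: lee_nneseries => n _ //.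
  apply: (le_trans (chebyshev (S n) (e0 n))).
  have VS : 'V_P[S n] <= ((N n)%:R * V n)%:E.
    apply: (@variance_sum (Y n) (2 ^+ n)%R).
    - exact: Y0.
    - move=> i l il; apply: independent_pair_comp; last exact: ind.
        exact: measurable_truncation.
      exact: measurable_truncation.
    - by move=> i; rewrite EY2 VE.
  apply: (@le_trans _ _ (((k.+1%:R^-1 * (N n)%:R) ^- 2)%:E * ((N n)%:R * V n)%:E)).
    by rewrite lee_pmul2l// lte_fin invr_gt0 exprn_gt0.
  have -> : 'E_P[g n \o Z 0%N] = (2 ^- n * V n)%:E.
    rewrite EFinM -VE !expectationE -ge0_integralZl//; last 2 first.
      by apply/measurable_EFinP; exact: (measurable_funX 2 (mY n 0%N)).
      by [move=> w _; rewrite lee_fin sqr_ge0 | rewrite lee_fin invr_ge0 exprn_ge0].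
  rewrite -!EFinM lee_fin NE /C.
  have p0 : (0 < 2 ^+ n :> R)%R by rewrite exprn_gt0.
  rewrite le_eqVlt; apply/orP; left; apply/eqP; field.
  by rewrite gt_eqF//= pnatr_eq0 -lt0n j0 nat1r pnatr_eq0.
by rewrite lte_mul_pinfty.
Qed.

Lemma truncated_expectation_cvg :
  fine 'E_P[truncation n \o Z 0%N] @[n --> \oo] --> fine 'E_P[Z 0%N].
Proof.
apply: fine_cvg; rewrite fineK; last first.
  by rewrite ge0_fin_numE// expectation_ge0.
under eq_fun do rewrite expectationE; rewrite expectationE.
have iZ : P.-integrable setT (EFin \o Z 0%N).
  apply/integrableP; split; first exact/measurable_EFinP.
  by under eq_integral do rewrite /= ger0_norm//; rewrite -expectationE.
apply: (@dominated_cvg _ _ _ P setT measurableT _ _ (EFin \o Z 0%N)) => //.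
- move=> n; apply/measurable_EFinP; exact: mY.
- move=> w _; apply: cvg_near_cst; near=> n; rewrite /= /truncation.
  suff -> : (Z 0%N w <= 2 ^+ n)%R by rewrite mulr1.
  near: n; have [m Hm] : exists m, (Z 0%N w <= m%:R)%R.
    by exists (Num.truncn (Z 0%N w)).+1; rewrite ltW// truncnS_gt.
  exists m => // n /= mn; apply: (le_trans Hm); rewrite -natrX ler_nat.
  by apply: (leq_trans mn); rewrite ltnW// ltn_expl.
- move=> n w _; rewrite /= lee_fin ger0_norm; last by have /andP[] := Y0 n 0 w.
  by rewrite /truncation ler_piMr// lern1 leq_b1.
Unshelve. all: by end_near. Qed.

Lemma strong_law_blocks : {ae P, forall w, forall e : R, (0 < e)%R ->
  \forall n \near \oo, (`| \sum_(i < (j * 2 ^ n)%N) Z i w -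
    (j * 2 ^ n)%:R * fine 'E_P[Z 0%N] | <= e * (j * 2 ^ n)%:R)%R}.
Proof.
have := blocks_eventually_small.
have := ae_foralln truncated_blocks_deviation.
apply: filterS2 => w dev small e e0.
have e20 : (0 < e / 2)%R by rewrite divr_gt0.
have [k _ kP] := near_infty_natSinv_lt (PosNum e20).
have {kP} := kP k (leqnn k) => /= ke.
have tr := truncated_expectation_cvg.
near=> n.
have -> : (\sum_(i < (j * 2 ^ n)%N) Z i w = \sum_(i < N n) truncation n (Z i w))%R.
  apply: eq_bigr => i _; rewrite /truncation.
  suff -> : (Z i w <= 2 ^+ n)%R by rewrite mulr1.
  by have := ltn_ord i; move: (nat_of_ord i); near: n.
have A : (`|\sum_(i < N n) truncation n (Z i w) -
    (N n)%:R * fine 'E_P[truncation n \o Z 0%N]| < k.+1%:R^-1 * (N n)%:R)%R.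
  by near: n; exact: dev.
have C : (`|fine 'E_P[Z 0%N] - fine 'E_P[truncation n \o Z 0%N]| < e / 2)%R.
  by near: n; move/cvgrPdist_lt : tr; apply.
rewrite -/(N n).
have := ler_distD ((N n)%:R * fine 'E_P[truncation n \o Z 0%N])%R
  (\sum_(i < N n) truncation n (Z i w))%R ((N n)%:R * fine 'E_P[Z 0%N])%R.
move=> /le_trans; apply.
rewrite [e in leRHS]splitr mulrDl lerD//.
  by apply: (le_trans (ltW A)); rewrite ler_wpM2r// ltW.
rewrite -mulrBr normrM ger0_norm// mulrC ler_wpM2r//.
by rewrite distrC ltW.
Unshelve. all: by end_near. Qed.

End Blocks.

End StrongLaw.

Section StrongLawIntegrable.
Context d (T : measurableType d) (R : realType) (P : probability T R).

(** A nondecreasing sequence that is asymptotically linear along each of the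
    progressions [j * 2 ^ n] is asymptotically linear: between [K * 2 ^ n] and
    [K * 2 ^ n.+1] these progressions have relative gaps at most [1 / K]. *)
Lemma cesaro_from_blocks (a : nat -> R) (mu : R) : (forall i, 0 <= a i) ->
  (forall j, (0 < j)%N -> forall e, 0 < e -> \forall n \near \oo,
    `|\sum_(i < (j * 2 ^ n)%N) a i - (j * 2 ^ n)%:R * mu| <=
      e * (j * 2 ^ n)%:R) ->
  N%:R^-1 * \sum_(i < N) a i @[N --> \oo] --> mu.
Proof.
move=> a0 blocks; pose S N := \sum_(i < N) a i.
have SS m n : (m <= n)%N -> S m <= S n.
  move=> mn; rewrite /S -!(big_mkord xpredT a) (big_cat_nat (leq0n m) mn)//=.
  by rewrite lerDl sumr_ge0.
apply/cvgrPdist_le => e e0.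
have [K K0 KP] : exists2 K, (0 < K)%N & `|mu| * 2 <= e * K%:R.
  exists (Num.truncn (`|mu| * 2 / e)).+1 => //.
  by rewrite -ler_pdivrMl// mulrC; apply/ltW/truncnS_gt.
have e40 : 0 < e / 4 by rewrite divr_gt0.
have [n0 _ n0P] : \forall n \near \oo, forall j : 'I_(2 * K).+1, (0 < j)%N ->
    `|S (j * 2 ^ n)%N - (j * 2 ^ n)%:R * mu| <= e / 4 * (j * 2 ^ n)%:R.
  apply: filter_forall => -[j jK] /=; case: j jK => [|j] jK.
    by apply: nearW => n.
  by have := blocks j.+1 (ltn0Sn j) _ e40; apply: filterS.
exists (K * 2 ^ n0)%N => // N /= nN.
(* [n] is chosen such that [N] lies between [j * 2 ^ n] and [j.+1 * 2 ^ n] for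
   some [j] with [K <= j < 2 * K]: finitely many progressions suffice *)
pose n := trunc_log 2 (N %/ K).
have NK : (2 ^ n0 <= N %/ K)%N by rewrite leq_divRL// mulnC.
have NK0 : (0 < N %/ K)%N by rewrite (leq_trans _ NK)// expn_gt0.
have n0n : (n0 <= n)%N by rewrite trunc_log_max.
have /andP[n1 n2] := trunc_log_bounds (isT : (1 < 2)%N) NK0.
rewrite -/n in n1 n2.
have KN : (K * 2 ^ n <= N)%N by rewrite mulnC -leq_divRL.
have NK' : (N < 2 * K * 2 ^ n)%N by rewrite mulnAC -expnS -ltn_divLR.
pose j := (N %/ 2 ^ n)%N.
have p2 : (0 < 2 ^ n)%N by rewrite expn_gt0.
have jK : (K <= j)%N by rewrite leq_divRL.
have j2K : (j < 2 * K)%N by rewrite ltn_divLR.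
have j0 : (0 < j)%N := leq_trans K0 jK.
have jN : (j * 2 ^ n <= N)%N by rewrite leq_trunc_div.
have Nj : (N <= j.+1 * 2 ^ n)%N by rewrite ltnW// ltn_ceil.
have N0 : (0 < N)%N by rewrite (leq_trans _ jN)// muln_gt0 j0.
have lo := n0P n n0n (@Ordinal (2 * K).+1 j (ltnW j2K)) j0.
have hi := n0P n n0n (@Ordinal (2 * K).+1 j.+1 j2K) (ltn0Sn j).
rewrite /= in lo hi.
have Slo := SS _ _ jN; have Shi := SS _ _ Nj.
have rN0 : 0 < N%:R :> R by rewrite ltr0n.
suff H : `|S N - N%:R * mu| <= e * N%:R.
  rewrite distrC -(ler_pM2r rN0) -[X in _ * X](gtr0_norm rN0) -normrM.
  by rewrite mulrBl mulrAC mulVf ?gt_eqF// mul1r (mulrC mu).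
pose q : R := (2 ^ n)%:R.
have jq : (j * 2 ^ n)%:R = j%:R * q by rewrite natrM.
have j1q : (j.+1 * 2 ^ n)%:R = j%:R * q + q by rewrite natrM -natr1 mulrDl mul1r.
rewrite jq in lo; rewrite j1q in hi.
have h1 : j%:R * q <= N%:R by rewrite -jq ler_nat.
have h2 : N%:R <= j%:R * q + q by rewrite -j1q ler_nat.
have q0 : 0 < q by rewrite ltr0n.
have h3 : `|mu| * q * 2 <= e * N%:R.
  apply: (@le_trans _ _ (e * (K%:R * q))).
    by rewrite mulrAC mulrA ler_pM2r.
  by rewrite ler_pM2l// -natrM ler_nat.
have h4 : q <= N%:R.
  by rewrite ler_nat (leq_trans _ KN)// leq_pmull.
have mn : - `|mu| <= mu <= `|mu| by rewrite -ler_norml.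
have h5 : `|(j%:R * q - N%:R) * mu| <= q * `|mu|.
  rewrite normrM ler_wpM2r// ler_norml; lra.
have h6 : `|(j%:R * q + q - N%:R) * mu| <= q * `|mu|.
  rewrite normrM ler_wpM2r// ler_norml; lra.
have h7 : e * q <= e * N%:R by rewrite ler_pM2l.
have h8 : e * (j%:R * q) <= e * N%:R by rewrite ler_pM2l.
move: lo hi h5 h6; rewrite !ler_norml => /andP[lo1 lo2] /andP[hi1 hi2].
move=> /andP[? ?] /andP[? ?]; apply/andP; split; nra.
Qed.

(** Etemadi's argument: nonnegativity makes the partial sums monotone, so that it
    suffices to control them along sparse progressions, where second moments of
    truncated variables are enough. *)
Theorem strong_law_ge0 (Z : {RV P >-> R}^nat) : (forall i w, 0 <= Z i w) ->
  ('E_P[Z 0%N] < +oo)%E -> (forall i, same_law P (Z i) (Z 0%N)) ->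
  (forall i k, i != k -> independent_pair P (Z i) (Z k)) ->
  {ae P, forall w,
    N%:R^-1 * \sum_(i < N) Z i w @[N --> \oo] --> fine 'E_P[Z 0%N]}.
Proof.
move=> Z0 EZ law ind.
have : {ae P, forall w, forall j, forall e : R, 0 < e ->
    \forall n \near \oo, `| \sum_(i < (j.+1 * 2 ^ n)%N) Z i w -
    (j.+1 * 2 ^ n)%:R * fine 'E_P[Z 0%N] | <= e * (j.+1 * 2 ^ n)%:R}.
  apply: ae_foralln => j; exact: strong_law_blocks.
apply: filterS => w H; apply: (@cesaro_from_blocks (fun i => Z i w)) => //.
by move=> [//|j] _; exact: H.
Qed.

Theorem strong_law (Z : {RV P >-> R}^nat) :
  P.-integrable setT (EFin \o Z 0%N) ->
  (forall i, same_law P (Z i) (Z 0%N)) ->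
  (forall i k, i != k -> independent_pair P (Z i) (Z k)) ->
  {ae P, forall w,
    N%:R^-1 * \sum_(i < N) Z i w @[N --> \oo] --> fine 'E_P[Z 0%N]}.
Proof.
move=> iZ law ind.
pose pos (x : R) : R := Num.max x 0; pose neg (x : R) : R := Num.max (- x) 0.
have mpos : measurable_fun setT pos by exact: measurable_maxr.
have mneg : measurable_fun setT neg by apply: measurable_maxr => //; exact: measurableT_comp.
have mp i := measurableT_comp mpos (measurable_funPT (Z i)).
have mn i := measurableT_comp mneg (measurable_funPT (Z i)).
pose Zp i : {RV P >-> R} := mfun_Sub (mem_set (mp i)).
pose Zn i : {RV P >-> R} := mfun_Sub (mem_set (mn i)).
have pos_le x : `|pos x| <= `|x|.
  by rewrite /pos ger0_norm ?le_max ?lexx ?orbT// ge_max ler_norm normr_ge0.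
have neg_le x : `|neg x| <= `|x|.
  by rewrite -(normrN x) /neg ger0_norm ?le_max ?lexx ?orbT// ge_max ler_norm normr_ge0.
have iZp : P.-integrable setT (EFin \o Zp 0%N).
  apply: le_integrable iZ => //; first by apply/measurable_EFinP.
  by move=> w _; rewrite /= lee_fin.
have iZn : P.-integrable setT (EFin \o Zn 0%N).
  apply: le_integrable iZ => //; first by apply/measurable_EFinP.
  by move=> w _; rewrite /= lee_fin.
have lawc (f : R -> R) (mf : measurable_fun setT f) i :
    same_law P (f \o Z i) (f \o Z 0%N).
  by move=> A mA; apply: (law i (f @^-1` A)); rewrite -[X in measurable X]setTI; exact: mf.
have Ep := strong_law_ge0 (Z := Zp) _ _ (lawc _ mpos)
  (fun i k ik => independent_pair_comp mpos mpos (ind i k ik)).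
have En := strong_law_ge0 (Z := Zn) _ _ (lawc _ mneg)
  (fun i k ik => independent_pair_comp mneg mneg (ind i k ik)).
have ZE i w : Z i w = Zp i w - Zn i w.
  rewrite /Zp/Zn/= /pos/neg/=; case: (lerP 0 (Z i w)) => z0.
    by rewrite max_r ?subr0// oppr_le0.
  by rewrite max_l ?sub0r ?opprK// oppr_ge0 ltW.
have EE : fine 'E_P[Z 0%N]%E = fine 'E_P[Zp 0%N]%E - fine 'E_P[Zn 0%N]%E.
  have -> : ('E_P[Z 0%N] = 'E_P[Zp 0%N] - 'E_P[Zn 0%N])%E.
    rewrite -expectationB; last 2 first.
      exact/Lfun1_integrable.
      exact/Lfun1_integrable.
    by congr expectation; apply/funext => w; exact: ZE.
  by rewrite fineB// expectation_fin_num//; exact/Lfun1_integrable.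
have {}Ep := Ep _ _; have {}En := En _ _.
have : {ae P, forall w, N%:R^-1 * \sum_(i < N) Zp i w @[N --> \oo] --> fine 'E_P[Zp 0%N]}.
  apply: Ep; first by move=> i w; rewrite le_max lexx orbT.
  rewrite expectationE; have /integrableP[_] := iZp.
  by under eq_integral do rewrite /= ger0_norm ?le_max ?lexx ?orbT//.
have : {ae P, forall w, N%:R^-1 * \sum_(i < N) Zn i w @[N --> \oo] --> fine 'E_P[Zn 0%N]}.
  apply: En; first by move=> i w; rewrite le_max lexx orbT.
  rewrite expectationE; have /integrableP[_] := iZn.
  by under eq_integral do rewrite /= ger0_norm ?le_max ?lexx ?orbT//.
apply: filterS2 => w cn cp.
have -> : (fun N => N%:R^-1 * \sum_(i < N) Z i w) =
   (fun N => N%:R^-1 * \sum_(i < N) Zp i w - N%:R^-1 * \sum_(i < N) Zn i w).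
  apply/funext => N; rewrite -mulrBr -sumrB; congr (_ * _).
  by apply: eq_bigr => i _; exact: ZE.
by rewrite EE; exact: cvgB.
Qed.

End StrongLawIntegrable.

(** * Samples of a completed law *)

Section Completion.
Context d (T : measurableType d) (R : realType).
Variable mu : {measure set T -> \bar R}.

Lemma completed_measurable_sigma_algebra :
  sigma_algebra setT (completed_measurable mu).
Proof.
split.
- by exists set0; rewrite ?setDv ?setU0//; exact: negligible_set0.
- move=> A [B mB AB]; exists (~` B); first exact: measurableC.
  rewrite setTD; apply: negligibleS AB => x /= [] [] nx /contrapT ?; by [right|left].
- move=> A mA.
  have /choice[B BP] n : exists B, measurable B /\
      mu.-negligible ((A n `\` B) `|` (B `\` A n)).
    by have [B ? ?] := mA n; exists B.
  exists (\bigcup_n B n); first by apply: bigcupT_measurable => n; have [] := BP n.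
  apply: (@negligibleS _ _ _ _ (\bigcup_n ((A n `\` B n) `|` (B n `\` A n)))).
    move=> x /= [[[n _ An] nB]|[[n _ Bn] nA]]; exists n => //=; [left|right].
      by split => // Bn; apply: nB; exists n.
    by split => // An; apply: nA; exists n.
  by apply: negligible_bigcup => n; have [] := BP n.
Qed.

Lemma completion_measurable (A : set T) :
  measurable (A : set (completion mu)) -> completed_measurable mu A.
Proof. by apply: smallest_sub => //; exact: completed_measurable_sigma_algebra. Qed.

Lemma measure_eq_negligible (A B : set T) : measurable A -> measurable B ->
  mu.-negligible ((A `\` B) `|` (B `\` A)) -> mu A = mu B.
Proof.
move=> mA mB [N [mN N0 NS]].
have H (C D : set T) : measurable C -> measurable D -> C `\` D `<=` N ->
    (mu C <= mu D)%E.
  move=> mC mD CD; rewrite -[leRHS]adde0 -N0.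
  apply: (@le_trans _ _ (mu (D `|` N))); last exact: measureU2.
  apply: le_measure; rewrite ?inE//; first exact: measurableU.
  move=> x Cx; have [Dx|nDx] := pselect (D x); first by left.
  by right; apply: CD.
apply/eqP; rewrite eq_le !H//.
  by move=> x ?; apply: NS; right.
by move=> x ?; apply: NS; left.
Qed.

End Completion.

Section LawMeasurable.
Context (R : realType) d (Omega : measurableType d) (P : probability Omega R).
Hypothesis P_complete : measure_is_complete P.
Context (Xi : ptopologicalType) (xi : {mfun Omega >-> borel Xi}).
Local Notation Xi' := (completion (law P xi)).

Lemma law_measurable_real (f : Xi -> R) :
  law_measurable (law P xi) f -> measurable_fun (setT : set Xi') f.
Proof.
move=> mf; apply: (measurability _ (RGenOpens.measurableE R)).
move=> _ [_ [a [b ->]] <-]; rewrite setTI.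
have := mf measurableT `]a, b[%classic; rewrite setTI; apply.
by apply: sub_sigma_algebra; exact: interval_open.
Qed.

Definition law_of_xi (X : {mfun Omega >-> borel Xi}) :=
  forall A, measurable A -> law P X A = law P xi A.

(** Completion adds subsets of null sets of the law: one Borel set represents [A]
    up to null sets for all random elements with this law simultaneously. *)
Lemma completed_preimage (A : set Xi) : measurable (A : set Xi') ->
  exists2 B : set (borel Xi), measurable B &
  forall X : {mfun Omega >-> borel Xi}, law_of_xi X ->
    P.-negligible ((X @^-1` A `\` X @^-1` B) `|` (X @^-1` B `\` X @^-1` A)).
Proof.
move=> /completion_measurable[B mB [N [mN N0 NS]]]; exists B => // X XL.
exists (X @^-1` N); split.
- by rewrite -[X in measurable X]setTI; exact: measurable_funPT.
- by have := XL N mN; rewrite N0.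
- by move=> w; exact: (NS (X w)).
Qed.

Lemma completed_preimage_measurable (A : set Xi) (X : {mfun Omega >-> borel Xi}) :
  law_of_xi X -> measurable (A : set Xi') -> measurable (X @^-1` A).
Proof.
move=> XL /completed_preimage[B mB /(_ X XL)] N.
have mXB : measurable (X @^-1` B).
  by rewrite -[X in measurable X]setTI; exact: measurable_funPT.
rewrite (_ : X @^-1` A = (X @^-1` B `\` (X @^-1` B `\` X @^-1` A)) `|`
    (X @^-1` A `\` X @^-1` B)).
  apply: measurableU; last by apply: P_complete; apply: negligibleS N; exact: subsetUl.
  apply: measurableD => //; apply: P_complete; apply: negligibleS N; exact: subsetUr.
apply/seteqP; split => w /=.
  move=> XA; have [XB|nXB] := pselect (B (X w)); last by right.
  by left; split => // -[].
by move=> [[XB nn]|[]//]; apply: contrapT => nA; apply: nn.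
Qed.

Lemma measurable_fun_sample (f : Xi -> R) (X : {mfun Omega >-> borel Xi}) :
  law_of_xi X -> law_measurable (law P xi) f ->
  measurable_fun setT (f \o X).
Proof.
move=> XL mf _ A mA; rewrite setTI.
apply: (completed_preimage_measurable (A := f @^-1` A) XL).
by have := law_measurable_real mf measurableT mA; rewrite setTI.
Qed.

Lemma same_law_sample (f : Xi -> R) (X X' : {mfun Omega >-> borel Xi}) :
  law_of_xi X -> law_of_xi X' -> law_measurable (law P xi) f ->
  same_law P (f \o X) (f \o X').
Proof.
move=> XL XL' mf A mA.
have mfA : measurable (f @^-1` A : set Xi').
  by have := law_measurable_real mf measurableT mA; rewrite setTI.
have [B mB BP] := completed_preimage mfA.
have E (Y : {mfun Omega >-> borel Xi}) (YL : law_of_xi Y) :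
    P ((f \o Y) @^-1` A) = law P xi B.
  rewrite -(YL _ mB); apply: measure_eq_negligible; last exact: BP.
    exact: (completed_preimage_measurable (A := f @^-1` A)).
  by rewrite -[X in measurable X]setTI; exact: measurable_funPT.
by rewrite !E.
Qed.

Lemma law_of_xi_id : law_of_xi xi. Proof. by []. Qed.

Variable sample : nat -> {mfun Omega >-> borel Xi}.
Hypothesis sample_law : forall i, law_of_xi (sample i).
Hypothesis sample_indep :
  independent_sequence P (fun i => sample i : Omega -> borel Xi).

Lemma independent_sample (f : Xi -> R) i j : i != j ->
  law_measurable (law P xi) f ->
  independent_pair P (f \o sample i) (f \o sample j).
Proof.
move=> ij mf A A' mA mA'.
have mfA : measurable (f @^-1` A : set Xi').
  by have := law_measurable_real mf measurableT mA; rewrite setTI.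
have mfA' : measurable (f @^-1` A' : set Xi').
  by have := law_measurable_real mf measurableT mA'; rewrite setTI.
have [B mB BP] := completed_preimage mfA.
have [B' mB' BP'] := completed_preimage mfA'.
have mS k (C : set (borel Xi)) : measurable C -> measurable (sample k @^-1` C).
  by move=> mC; rewrite -[X in measurable X]setTI; exact: measurable_funPT.
have mSA k (C : set Xi) : measurable (C : set Xi') -> measurable (sample k @^-1` C).
  by move=> mC; exact: completed_preimage_measurable.
have -> : P ((f \o sample i) @^-1` A) = P (sample i @^-1` B).
  by apply: measure_eq_negligible; [exact: (mSA i (f @^-1` A))|exact: mS|exact: BP].
have -> : P ((f \o sample j) @^-1` A') = P (sample j @^-1` B').
  by apply: measure_eq_negligible; [exact: (mSA j (f @^-1` A'))|exact: mS|exact: BP'].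
have -> : P ((f \o sample i) @^-1` A `&` (f \o sample j) @^-1` A') =
    P (sample i @^-1` B `&` sample j @^-1` B').
  apply: measure_eq_negligible.
  - by apply: measurableI; [exact: (mSA i (f @^-1` A))|exact: (mSA j (f @^-1` A'))].
  - by apply: measurableI; exact: mS.
  - apply: (negligibleS _ (negligibleU (BP _ (sample_law i)) (BP' _ (sample_law j)))).
    move=> w [[[a b] /not_andP[n|n]]|[[a b] /not_andP[n|n]]].
    + by left; left.
    + by right; left.
    + by left; right.
    + by right; right.
have := @sample_indep [fset i; j]%fset (fun k => if k == i then B else B').
rewrite big_fsetU1 ?inE//= big_seq_fset1 eqxx eq_sym (negbTE ij) => <-; last first.
  by move=> k; case: ifP.
congr (P _); apply/seteqP; split => w /=.
  move=> [Bi Bj] k /=; rewrite !inE => /orP[] /eqP -> /=; first by rewrite eqxx.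
  by rewrite eq_sym (negbTE ij).
move=> H; split.
  by have := H i; rewrite /= !inE eqxx/=; apply.
by have := H j; rewrite /= !inE eqxx orbT/= eq_sym (negbTE ij); apply.
Qed.

(** The integrands of interest are measurable for the completed sigma-algebra
    only, whereas independence and equality of laws are about Borel sets; both
    transfer by [completed_preimage]. *)
Theorem strong_law_sample (f : Xi -> R) : law_measurable (law P xi) f ->
  P.-integrable setT (fun w => (f (xi w))%:E) ->
  {ae P, forall w, N%:R^-1 * \sum_(i < N) f (sample i w) @[N --> \oo] -->
    fine 'E_P[f \o xi]%E}.
Proof.
move=> mf intf.
pose Z i : {RV P >-> R} :=
  mfun_Sub (mem_set (measurable_fun_sample (sample_law i) mf)).
pose Zxi : {RV P >-> R} :=
  mfun_Sub (mem_set (measurable_fun_sample law_of_xi_id mf)).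
have sl := same_law_sample (sample_law 0%N) law_of_xi_id mf.
have iZ0 : P.-integrable setT (EFin \o Z 0%N).
  apply/integrableP; split; first exact/measurable_EFinP.
  have /integrableP[_] := intf; apply: le_lt_trans; rewrite le_eqVlt; apply/orP; left.
  apply/eqP; have := @same_law_expectation _ _ _ P (Z 0%N) Zxi (fun x => `|x|) _ _ sl.
  by rewrite !expectationE; apply.
have -> : 'E_P[f \o xi]%E = 'E_P[Z 0%N]%E.
  rewrite !expectationE -(@integral_distribution _ _ _ _ _ P (Z 0%N) EFin)//.
  rewrite -[LHS](@integral_distribution _ _ _ _ _ P Zxi EFin)//.
  by apply: eq_measure_integral => A mA _; apply/esym; exact: sl.
apply: strong_law => //.
- by move=> i; exact: same_law_sample.
- by move=> i k ik; exact: independent_sample.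
Qed.

End LawMeasurable.

(** * Differential calculus in normed spaces *)

Section BoundedOperators.
Context {R : realType} {V W : normedModType R}.

Lemma blin_le (f : blin V W) x : `|f x| <= `|f| * `|x|.
Proof.
have [->|x0] := eqVneq x 0; first by rewrite linear0 !normr0 mulr0.
have nx0 : 0 < `|x| by rewrite normr_gt0.
have : `|f (`|x|^-1 *: x)| <= op_norm f.
  by apply: op_norm_ub; rewrite normrZ normfV normr_id mulVf// gt_eqF.
by rewrite linearZ/= normrZ normfV normr_id ler_pdivrMl// mulrC.
Qed.

Lemma blin_ext (f g : blin V W) : (forall x, f x = g x) -> f = g.
Proof. by move=> fg; apply/val_inj/funext. Qed.

Lemma differentiable_eps (f : V -> W) x : differentiable f x ->
  forall e, 0 < e ->
  \forall h \near 0, `|f (x + h) - f x - fderiv f x h| <= e * `|h|.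
Proof.
move=> df e e0.
have fE : fderiv f x = 'd f x :> (V -> W).
  rewrite /fderiv -[LHS]/(val (insubd 0 _)) insubdK//.
  apply/asboolP; split; last exact: diff_continuous.
  by move=> a u v; rewrite linearP.
have := diff_locally df => /eqaddoP /(_ e e0).
apply: filterS => h; rewrite fE.
by rewrite -[X in `|X| <= _ -> _]/(f (h + x) - (f x + 'd f x h)) opprD addrA (addrC h).
Qed.

(** The way in which derivatives are computed below: an epsilon estimate for a
    bounded operator identifies it with [fderiv]. *)
Lemma fderiv_unique (f : V -> W) x (D : blin V W) :
  (forall e, 0 < e -> \forall h \near 0, `|f (x + h) - f x - D h| <= e * `|h|) ->
  differentiable f x /\ fderiv f x = D.
Proof.
move=> H.
have E : f \o shift x = cst (f x) + (D : V -> W) +o_ 0 id.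
  apply/eqaddoP => e e0; apply: filterS (H e e0) => h.
  by rewrite -[X in _ -> `|X| <= _]/(f (h + x) - (f x + D h)) opprD addrA (addrC h).
have dE := diff_unique (@blin_continuous _ _ _ D) E.
have df : differentiable f x.
  apply/diff_locallyP; rewrite dE; split; [exact: blin_continuous|exact: E].
split=> //; apply: blin_ext => h.
rewrite /fderiv -[LHS]/(val (insubd 0 _) h) insubdK ?dE//.
by apply/asboolP; split; [exact: blin_linear|exact: blin_continuous].
Qed.

Lemma blin_predI (f : V -> W) M : linear f ->
  (forall x, `|f x| <= M * `|x|) -> f \in @blin_pred R V W.
Proof.
move=> lf fM; apply/asboolP; split => //.
pose f' : {linear V -> W} := HB.pack f (GRing.isLinear.Build R V W *:%R f lf).
apply: (@bounded_linear_continuous _ _ _ f').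
apply/linear_boundedP; near=> r => x; apply: (le_trans (fM x)).
by rewrite ler_wpM2r.
Unshelve. all: by end_near. Qed.

End BoundedOperators.

Section SegmentGrowth.
Context {R : realType}.

(** The supremum of the points up to which the bound holds has to be [1], since
    the bound passes to limits and can be continued locally. *)
Lemma segment_growth {V : normedModType R} (f : R -> V) (M : R) :
  (forall t e : R, 0 <= t <= 1 -> 0 < e -> \forall s \near t, 0 <= s <= 1 ->
    `|f s - f t| <= (M + e) * `|s - t|) ->
  `|f 1 - f 0| <= M.
Proof.
move=> H; apply/ler_addgt0Pr => e e0.
pose S := [set t : R | 0 <= t <= 1 /\ `|f t - f 0| <= (M + e) * t].
have S0 : S 0 by rewrite /S/= lexx ler01 subrr normr0 mulr0.
have Sub : has_sup S.
  by split; [exists 0|exists 1 => t [/andP[]]].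
pose c := sup S.
have Sc t : S t -> t <= c by move=> St; apply: ub_le_sup => //; case: Sub.
have c1 : c <= 1 by apply: ge_sup; [exists 0|move=> t [/andP[]]].
have c01 : 0 <= c <= 1 by rewrite Sc.
have [r /= r0 Hr] := H c e c01 e0.
have {}Hr s : `|c - s| < r -> 0 <= s <= 1 -> `|f s - f c| <= (M + e) * `|s - c|.
  exact: Hr.
have fc : `|f c - f 0| <= (M + e) * c.
  have [t [t01 St] ct] := sup_adherent r0 Sub.
  have tc := Sc _ (conj t01 St).
  have := Hr t; rewrite ger0_norm ?subr_ge0// distrC => /(_ _ t01).
  rewrite ltrBlDr -ltrBlDl => /(_ ct).
  rewrite ler0_norm ?subr_le0// opprB => ft.
  apply: (le_trans (ler_distD (f t) _ _)).
  by rewrite -(subrK t c) mulrDr subrK lerD.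
have [cl1|] := ltP c 1; last first.
  by move=> c1'; have <- : c = 1 by [apply/eqP; rewrite eq_le c1]; move: fc;
     rewrite (_ : c = 1) ?mulr1//; apply/eqP; rewrite eq_le c1.
pose s := Num.min 1 (c + r / 2).
have r20 : 0 < r / 2 by rewrite divr_gt0.
have cs : c < s by rewrite lt_min cl1 ltrDl.
have s1 : s <= 1 by rewrite ge_min lexx.
have s0 : 0 <= s by rewrite (le_trans _ (ltW cs))//; case/andP: c01.
have sr : s - c < r.
  rewrite ltrBlDl (@le_lt_trans _ _ (c + r / 2))//; first by rewrite ge_min lexx orbT.
  by rewrite ltrD2l ltr_pdivrMr// ltr_pMr// ltr1n.
have : S s.
  split; first by rewrite s0.
  apply: (le_trans (ler_distD (f c) _ _)).
  rewrite -[in leRHS](subrK c s) mulrDr lerD//.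
  have A : `|c - s| < r by rewrite distrC gtr0_norm ?subr_gt0.
  by have := Hr s A; rewrite s0 s1 (gtr0_norm (x := s - c)) ?subr_gt0// => /(_ isT).
by move=> /Sc; rewrite leNgt cs.
Qed.

(** A bound on the derivative in the direction of the segment suffices; no other
    direction is controlled in [constraint_increment]. *)
Lemma mean_value_ineq {V W : normedModType R} (g : V -> W) (x h : V) (M : R) :
  (forall t : R, 0 <= t <= 1 -> differentiable g (x + t *: h)) ->
  (forall t : R, 0 <= t <= 1 -> `|fderiv g (x + t *: h) h| <= M) ->
  `|g (x + h) - g x| <= M.
Proof.
move=> dg gM.
have M0 : 0 <= M by apply: le_trans (gM 0 _); rewrite ?lexx ?ler01.
have := @segment_growth _ (fun t => g (x + t *: h)) M.
rewrite scale1r scale0r addr0; apply => t e t01 e0.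
have d0 : 0 < e / (`|h| + 1) by rewrite divr_gt0// ltr_wpDl.
have := differentiable_eps (dg t t01) d0.
move=> /nbhs_ballP[r /= r0 Hr].
exists (r / (`|h| + 1)); first by rewrite /= divr_gt0// ltr_wpDl.
move=> s /= ts s01.
have := Hr ((s - t) *: h); rewrite -ball_normE /= sub0r normrN normrZ.
have hts : `|s - t| * `|h| < r.
  rewrite distrC in ts; move: ts; rewrite ltr_pdivlMr ?ltr_wpDl//; apply: le_lt_trans.
  by rewrite ler_wpM2l// lerDl.
have -> : x + t *: h + (s - t) *: h = x + s *: h.
  by rewrite -addrA -scalerDl addrCA subrr addr0.
move=> /(_ hts); rewrite linearZ/= => A.
rewrite -[X in `|X| <= _](subrK ((s - t) *: fderiv g (x + t *: h) h)).
apply: (le_trans (ler_normD _ _)); rewrite mulrDl addrC lerD//.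
  by rewrite normrZ mulrC ler_wpM2r// gM.
apply: (le_trans A); rewrite mulrCA mulrC ler_wpM2r//.
rewrite mulrAC ler_pdivrMr ?ltr_wpDl//.
by rewrite ler_pM2l// lerDl.
Qed.

(** The mean value inequality for [g - D]. *)
Lemma mean_value_ineqB {V W : normedModType R} (g : V -> W) (x h : V)
    (D : blin V W) (M : R) :
  (forall t : R, 0 <= t <= 1 -> differentiable g (x + t *: h)) ->
  (forall t : R, 0 <= t <= 1 -> `|fderiv g (x + t *: h) h - D h| <= M) ->
  `|g (x + h) - g x - D h| <= M.
Proof.
move=> dg gM.
have dgD t : 0 <= t <= 1 ->
    differentiable (fun y => g y - D y) (x + t *: h) /\
    fderiv (fun y => g y - D y) (x + t *: h) = fderiv g (x + t *: h) - D.
  move=> t01; apply: fderiv_unique => e e0.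
  apply: filterS (differentiable_eps (dg t t01) e0) => k.
  rewrite -[X in _ -> `|_ - X| <= _]/(fderiv g (x + t *: h) k - D k).
  rewrite (_ : g (x + t *: h + k) - D (x + t *: h + k) - _ - _ =
    g (x + t *: h + k) - g (x + t *: h) - fderiv g (x + t *: h) k)//.
  rewrite (linearD D); set a := g _; set b := g _; set c := D _; set f := D _; set l := fderiv _ _ _.
  by rewrite !opprD !opprK !addrA [LHS](ACl (1*4*6*(2*5)*(3*7)))/= !addNr !addr0.
have := @mean_value_ineq _ _ (fun y => g y - D y) x h M.
rewrite (_ : g (x + h) - D (x + h) - (g x - D x) = g (x + h) - g x - D h).
  by apply => t t01; [exact: (dgD t t01).1|rewrite (dgD t t01).2; exact: gM].
by rewrite (linearD D) !opprD !opprK !addrA [LHS](ACl (1*4*3*(2*5)))/= addNr addr0.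
Qed.

End SegmentGrowth.

Section CompactParameter.
Context {R : realType} {T : topologicalType} {W : normedModType R}.

(** The tube lemma: continuity that is joint with a compact parameter is uniform
    in the parameter. *)
Lemma compact_parameter_uniform {Z : normedModType R} (A : set W)
    (f : W * T -> Z) (w : W) : compact [set: T] ->
  {within A `*` [set: T], continuous f} -> A w ->
  forall e, 0 < e -> \forall v \near w, A v -> forall x, `|f (v, x) - f (w, x)| <= e.
Proof.
move=> /compact_near_coveringP cT /subspace_continuousP cf Aw e e0.
have e20 : 0 < e / 2 by rewrite divr_gt0.
suff : \forall v \near w, [set: T] `<=` (fun x => A v -> `|f (v, x) - f (w, x)| <= e).
  by apply: filterS => v H Av x; exact: H.
apply: (cT W (nbhs w) (fun v x => A v -> `|f (v, x) - f (w, x)| <= e)) => x _.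
have := cf (w, x) (conj Aw I) => /cvgrPdist_lt /(_ _ e20) [[U V] /= [Uw Vx] UV].
exists (V, U) => //= -[y v] /= [Vy Uv] Av.
have A1 := UV (v, y) (conj Uv Vy) (conj Av I).
have A2 := UV (w, y) (conj (nbhs_singleton Uw) Vy) (conj Aw I).
rewrite [e]splitr (le_trans (ler_distD (f (w, x)) _ _))// lerD//.
  by rewrite distrC ltW.
by rewrite ltW.
Qed.

End CompactParameter.

(** Sums of an interval function over dyadic partitions. Defining them by
    bisection lets every estimate go by induction on the depth, over all
    intervals at once. *)
Section DyadicSums.
Context {R : realType}.

Fixpoint dyadic_sum {V : zmodType} (L : R -> R -> V) (n : nat) (a b : R) : V :=
  if n is n'.+1 then
    dyadic_sum L n' a ((a + b) / 2) + dyadic_sum L n' ((a + b) / 2) b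
  else L a b.

Lemma dyadic_sum_additive {V : zmodType} (L : R -> R -> V) n a b :
  (forall x y z, L x z = L x y + L y z) -> dyadic_sum L n a b = L a b.
Proof. by move=> Ladd; elim: n a b => //= n IH a b; rewrite !IH -Ladd. Qed.

Lemma dyadic_sumD {V : zmodType} (L : R -> R -> V) n k a b :
  dyadic_sum (dyadic_sum L k) n a b = dyadic_sum L (n + k) a b.
Proof. by elim: n a b => //= n IH a b; rewrite !IH. Qed.

Lemma dyadic_sum_linear {V W : lmodType R} (f : {linear V -> W}) L n a b :
  f (dyadic_sum L n a b) = dyadic_sum (fun x y => f (L x y)) n a b.
Proof. by elim: n a b => //= n IH a b; rewrite linearD !IH. Qed.

Lemma dyadic_sum_dist {V : normedModType R} (L L' : R -> R -> V) M n a b :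
  a <= b ->
  (forall x y, a <= x -> x <= y -> y <= b -> y - x = (b - a) / 2 ^+ n ->
    `|L x y - L' x y| <= M * (y - x)) ->
  `|dyadic_sum L n a b - dyadic_sum L' n a b| <= M * (b - a).
Proof.
elim: n a b => [|n IH] a b ab LL' /=.
  by apply: LL' => //; rewrite expr0 divr1.
set m := (a + b) / 2.
have h1 : m - a = (b - a) / 2 by rewrite /m; field.
have h2 : b - m = (b - a) / 2 by rewrite /m; field.
have am : a <= m by rewrite -subr_ge0 h1 divr_ge0// subr_ge0.
have mb : m <= b by rewrite -subr_ge0 h2 divr_ge0// subr_ge0.
have -> : M * (b - a) = M * (m - a) + M * (b - m) by ring.
rewrite opprD addrACA; apply: (le_trans (ler_normD _ _)); apply: lerD.
  apply: IH => // x y ax xy ym E; apply: LL' => //; first exact: le_trans mb.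
  by rewrite E h1 exprS invfM mulrA.
apply: IH => // x y mx xy yb E; apply: LL' => //; first exact: le_trans mx.
by rewrite E h2 exprS invfM mulrA.
Qed.

Lemma dyadic_sum_near {V : normedModType R} (c : R -> V) (v : V) e n a b :
  a <= b -> (forall t, a <= t <= b -> `|c t - v| <= e) ->
  `|dyadic_sum (fun x y => (y - x) *: c x) n a b - (b - a) *: v| <= e * (b - a).
Proof.
move=> ab cv.
rewrite -(@dyadic_sum_additive _ (fun x y => (y - x) *: v) n); last first.
  by move=> x y z; rewrite -scalerDl [y - x + _]addrC subrKA.
apply: dyadic_sum_dist => // x y ax xy yb _.
rewrite -scalerBr normrZ ger0_norm ?subr_ge0// mulrC ler_wpM2r ?subr_ge0//.
by apply: cv; rewrite ax (le_trans xy).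
Qed.

(** If [c] is the candidate derivative, with values in a complete space [Y], of a
    curve that is only known to be differentiable in a larger space [Y0], then
    the Riemann sums of [c] converge in [Y], so the increment of the curve is
    controlled in the norm of [Y]. *)
Lemma increment_in_subspace {Y : completeNormedModType R}
    {Y0 : normedModType R} (iota : {linear Y -> Y0})
    (c : R -> Y) (phi : R -> Y0) (y v : Y) (e : R) :
  injective iota -> continuous iota ->
  (forall d, 0 < d -> exists2 r, 0 < r & forall s t, 0 <= s <= 1 -> 0 <= t <= 1 ->
    `|s - t| <= r -> `|c s - c t| <= d) ->
  (forall s t d, 0 <= s -> s <= t -> t <= 1 ->
    (forall q, s <= q <= t -> `|iota (c q) - iota (c s)| <= d) ->
    `|phi t - phi s - (t - s) *: iota (c s)| <= d * (t - s)) ->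
  iota y = phi 1 - phi 0 ->
  (forall t, 0 <= t <= 1 -> `|c t - v| <= e) -> `|y - v| <= e.
Proof.
move=> iota_inj iota_cont c_unif phi_c iy cv.
have [k k0 iotak] := linear_lipschitz iota_cont.
pose L (s t : R) : Y := (t - s) *: c s.
pose S n := dyadic_sum L n 0 1.
have fine d : 0 < d -> exists n0, forall n, (n0 <= n)%N ->
    `|S n - S n0| <= d /\ `|iota (S n) - (phi 1 - phi 0)| <= k * d.
  move=> d0; have [r r0 cr] := c_unif d d0.
  have [n0 n0r] : exists n0, 1 <= r * 2 ^+ n0.
    exists (Num.truncn r^-1).+1; rewrite -ler_pdivrMl// mulr1.
    apply: (le_trans (ltW (truncnS_gt _))); rewrite -natrX ler_nat ltnW//.
    exact: ltn_expl.
  have small n s t : (n0 <= n)%N -> t - s = 1 / 2 ^+ n -> t - s <= r.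
    move=> nn0 ->; rewrite ler_pdivrMr ?exprn_gt0//.
    by apply: (le_trans n0r); rewrite ler_pM2l// ler_eXn2l// ltr1n.
  have osc n s t q : (n0 <= n)%N -> 0 <= s -> t <= 1 ->
      t - s = 1 / 2 ^+ n -> s <= q <= t -> `|c q - c s| <= d.
    move=> nn0 s0 t1 E /andP[sq qt]; apply: cr.
    - by rewrite (le_trans s0 sq) (le_trans qt).
    - by rewrite s0 (le_trans sq)// (le_trans qt).
    - by rewrite ger0_norm ?subr_ge0// (le_trans _ (small _ _ _ nn0 E))// lerD2r.
  exists n0 => n nn0; split.
    rewrite /S -(subnKC nn0) -dyadic_sumD.
    have := @dyadic_sum_dist _ (dyadic_sum L (n - n0)) L d n0 0 1 ler01.
    rewrite subr0 mulr1; apply => s t s0 st t1 E.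
    by apply: dyadic_sum_near => // q; exact: (osc n0).
  rewrite /S dyadic_sum_linear.
  rewrite -(@dyadic_sum_additive _ (fun s t => phi t - phi s) n); last first.
    by move=> a b z; rewrite [phi b - _ + _]addrC subrKA.
  have := @dyadic_sum_dist _ (fun s t => iota (L s t)) (fun s t => phi t - phi s) (k * d) n 0 1 ler01.
  rewrite subr0 mulr1; apply => s t s0 st t1 E.
  rewrite /L linearZ distrC; apply: phi_c => // q sqt.
  rewrite -linearB; apply: (le_trans (iotak _)); rewrite ler_pM2l//.
  exact: (osc n s t).
have cS : cvg (S @ \oo).
  apply/cauchy_cvgP/cauchy_exP => d d0.
  have d20 : 0 < d / 2 by rewrite divr_gt0.
  have [n0 n0P] := fine _ d20; exists (S n0), n0 => // n /= n0n.
  rewrite -ball_normE /ball_ /= distrC.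
  by apply: (le_lt_trans (n0P n n0n).1); rewrite ltr_pdivrMr// ltr_pMr// ltr1n.
have yS d : 0 < d -> \forall n \near \oo, `|y - S n| <= d.
  suff -> : y = lim (S @ \oo) by move=> d0; move/cvgrPdist_le : cS; apply.
  apply: iota_inj; rewrite iy; apply/esym/eqP; rewrite -subr_eq0 -normr_le0.
  apply/ler_addgt0Pr => {}d d0; rewrite add0r.
  have d'0 : 0 < d / (2 * k) by rewrite divr_gt0// mulr_gt0.
  have [n0 n0P] := fine _ d'0.
  have : \forall n \near \oo, `|lim (S @ \oo) - S n| <= d / (2 * k).
    by move/cvgrPdist_le : cS; apply.
  move=> [n1 _ n1P]; have {n0P}[_ A] := n0P (maxn n0 n1) (leq_maxl _ _).
  have {n1P}C := n1P (maxn n0 n1) (leq_maxr _ _).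
  rewrite (le_trans (ler_distD (iota (S (maxn n0 n1))) _ _))//.
  have -> : d = k * (d / (2 * k)) + k * (d / (2 * k)) by field; rewrite gt_eqF.
  rewrite lerD// -linearB; apply: (le_trans (iotak _)).
  by rewrite ler_pM2l.
apply/ler_addgt0Pr => d d0; have [n _ nP] := yS d d0.
rewrite (le_trans (ler_distD (S n) _ _))// addrC lerD//; last exact: nP n (leqnn n).
have := @dyadic_sum_near _ c v e n 0 1 ler01 cv.
by rewrite subr0 scale1r mulr1.
Qed.

End DyadicSums.

Section Sequences.
Context {R : realType}.

(** Neighborhoods are detected by sequences, here with a prescribed rate; this
    makes theorems on sequences of functions available for Frechet
    derivatives. *)
Lemma near_seq {V : normedModType R} (x : V) (A : set V) :
  (forall u : nat -> V, (forall n, `|u n - x| < n.+1%:R^-1) -> exists n, A (u n)) ->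
  \forall y \near x, A y.
Proof.
move=> H; apply: contrapT => nA.
have /choice[u uP] n : exists y, `|y - x| < n.+1%:R^-1 /\ ~ A y.
  apply: contrapT => /forallNP nE; apply: nA; apply/nbhs_ballP; exists n.+1%:R^-1 => /=.
    by rewrite invr_gt0.
  rewrite -ball_normE => y /= xy; apply: contrapT => Ay; apply: (nE y).
  by split => //; rewrite distrC.
have [n An] := H u (fun n => (uP n).1).
by have := (uP n).2; apply.
Qed.

Lemma cvg_of_rate {V : normedModType R} (u : nat -> V) (x : V) :
  (forall n, `|u n - x| < n.+1%:R^-1) -> u @ \oo --> x.
Proof.
move=> ux; apply/cvgrPdist_lt => e e0.
have := near_infty_natSinv_lt (PosNum e0); apply: filterS => n /= ne.
by rewrite distrC (lt_trans (ux n)).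
Qed.

Lemma sequentially_continuous {V W : normedModType R} (f : V -> W) :
  (forall (u_ : nat -> V) u, u_ @ \oo --> u -> f (u_ n) @[n --> \oo] --> f u) ->
  continuous f.
Proof.
move=> H u; apply/cvgrPdist_lt => e e0; apply: near_seq => u_ u_u.
have /cvgrPdist_lt/(_ e e0)[n _ nP] := H _ _ (cvg_of_rate u_u).
by exists n; apply: nP => /=.
Qed.

Lemma lipschitz_continuous {V W : normedModType R} (f : V -> W) k :
  (forall x y, `|f x - f y| <= k * `|x - y|) -> continuous f.
Proof.
move=> fk x; apply/cvgrPdist_le => e e0.
have e'0 : 0 < e / (`|k| + 1) by rewrite divr_gt0// ltr_wpDl.
have /cvgrPdist_le/(_ _ e'0) : y @[y --> x] --> x by exact: cvg_id.
apply: filterS => y xy; apply: (le_trans (fk _ _)).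
apply: (@le_trans _ _ ((`|k| + 1) * (e / (`|k| + 1)))).
  rewrite (le_trans (ler_wpM2r _ (ler_norm k)))// ler_pM//.
  by rewrite lerDl.
by rewrite mulrC divfK// gt_eqF// ltr_wpDl.
Qed.

Lemma blin_eval_continuous {V W : normedModType R} (z : V) :
  continuous (fun f : blin V W => f z).
Proof.
apply: (@lipschitz_continuous (blin V W) W _ `|z|) => f g.
by rewrite mulrC; exact: (blin_le (f - g) z).
Qed.

Lemma dense_sequence {T : ptopologicalType} : separable T ->
  exists s : nat -> T, forall O : set T, open O -> O !=set0 -> exists n, O (s n).
Proof.
move=> [S /countable_injP [f finj] dS].
exists (fun n => xget point [set s | S s /\ f s = n]) => O oO O0.
have [y [Oy Sy]] := dS O O0 oO.
exists (f y); case: xgetP => [z _ [Sz fz]|/(_ y)]; last by case.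
by rewrite (_ : z = y)//; apply: finj; rewrite ?inE.
Qed.

Lemma dense_sequence_norm {V : normedModType R} : separable V ->
  exists s : nat -> V, forall (x : V) e, 0 < e -> exists n, `|s n - x| < e.
Proof.
move=> /dense_sequence[s sP]; exists s => x e e0.
have [||n] := sP (ball x e); first exact: ball_open.
  by exists x; exact: ballxx.
by rewrite -ball_normE /= distrC; exists n.
Qed.

Lemma unit_interval_uniform {V : normedModType R} (c : R -> V) :
  (forall t e : R, 0 <= t <= 1 -> 0 < e ->
    \forall s \near t, 0 <= s <= 1 -> `|c s - c t| <= e) ->
  forall d : R, 0 < d -> exists2 r : R, 0 < r &
    forall s t : R, 0 <= s <= 1 -> 0 <= t <= 1 -> `|s - t| <= r -> `|c s - c t| <= d.
Proof.
move=> cc d d0; have d20 : 0 < d / 2 by rewrite divr_gt0.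
have /compact_near_coveringP cpt := @segment_compact R 0 1.
have : \forall r \near (0 : R), `[0, 1]%classic `<=` (fun t : R => 0 <= t <= 1 ->
    forall s, 0 <= s <= 1 -> `|s - t| <= r -> `|c s - c t| <= d).
  apply: (cpt R (nbhs (0:R)) (fun r t => 0 <= t <= 1 ->
    forall s, 0 <= s <= 1 -> `|s - t| <= r -> `|c s - c t| <= d)) => t.
  rewrite /= in_itv/= => t01; have [e /= e0 He] := cc t _ t01 d20.
  exists (ball t (e / 2), ball (0:R) (e / 2)).
    by split; apply: nbhsx_ballx; rewrite divr_gt0.
  move=> [t' r] /= [tt' r0] t'01 s s01 st'.
  rewrite /ball/= sub0r normrN in r0; rewrite /ball/= in tt'.
  have rr : r < e / 2 by rewrite (le_lt_trans (ler_norm r)).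
  have e2e : e / 2 < e by rewrite ltr_pdivrMr// ltr_pMr// ltr1n.
  have A : `|c t' - c t| <= d / 2 by apply: He => //=; exact: lt_trans e2e.
  have C : `|c s - c t| <= d / 2.
    apply: He => //=; rewrite (le_lt_trans (ler_distD t' _ _))//.
    by rewrite [e]splitr ltr_leD// (le_trans _ (ltW rr))// distrC.
  by rewrite [d]splitr (le_trans (ler_distD (c t) _ _))// lerD// distrC.
move=> [r /= r0 Hr]; exists (r / 2); first by rewrite divr_gt0.
move=> s t s01 t01; apply: (Hr (r / 2)) => //=.
  by rewrite sub0r normrN gtr0_norm ?divr_gt0// ltr_pdivrMr// ltr_pMr// ltr1n.
Qed.

Lemma near_segment {V : normedModType R} (u : V) (A : set V) : nbhs u A ->
  \forall h \near 0, forall t : R, 0 <= t <= 1 -> A (u + t *: h).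
Proof.
move=> /nbhs_ballP[r /= r0 rA]; apply/nbhs_ballP; exists r => // h.
rewrite -ball_normE /= sub0r normrN => hr t /andP[t0 t1]; apply: rA.
rewrite -ball_normE /= opprD addNKr normrN normrZ ger0_norm//.
by apply: le_lt_trans hr; rewrite ler_piMl.
Qed.

Lemma near_subseq (Q : nat -> Prop) (k : nat -> nat) :
  {homo k : m n / (m < n)%N} -> (\forall n \near \oo, Q n) ->
  \forall n \near \oo, Q (k n).
Proof.
move=> kk [n0 _ n0P].
have kn n : (n <= k n)%N by elim: n => // n IH; exact: leq_ltn_trans (kk n n.+1 _).
by exists n0 => // n /= n0n; apply: n0P => /=; exact: leq_trans (kn n).
Qed.

Lemma cvg_subseq {T : topologicalType} (f : nat -> T) (l : T) (k : nat -> nat) :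
  {homo k : m n / (m < n)%N} -> f @ \oo --> l -> f (k n) @[n --> \oo] --> l.
Proof. by move=> kk fl A /fl Af; exact: (near_subseq kk Af). Qed.

Lemma cvg_congr {T : topologicalType} (f g : nat -> T) (a b : T) :
  (forall n, f n = g n) -> a = b -> g @ \oo --> b -> f @ \oo --> a.
Proof. by move=> /funext -> ->. Qed.

End Sequences.

Section Operators.
Context {R : realType} {X : normedModType R} {W : normedModType R}.

Lemma weakstar_cvg_of_norm (u_ : nat -> dual X) (u : dual X) :
  u_ @ \oo --> u -> weakstar_cvg u_ u.
Proof.
move=> uu x; apply/cvgrPdist_le => e e0.
have e'0 : 0 < e / (`|x| + 1) by rewrite divr_gt0// ltr_wpDl.
move/cvgrPdist_le : uu => /(_ _ e'0); apply: filterS => n un.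
apply: (le_trans (blin_le (u - u_ n) x)).
apply: (@le_trans _ _ (e / (`|x| + 1) * (`|x| + 1))).
  by apply: ler_pM => //; rewrite lerDl.
by rewrite divfK// gt_eqF// ltr_wpDl.
Qed.

Lemma weakstar_to_strong_continuous (B : {linear dual X -> W}) :
  (forall (u_ : nat -> dual X) (u : dual X),
    weakstar_cvg u_ u -> B (u_ n) @[n --> \oo] --> B u) -> continuous B.
Proof.
move=> BB; apply: sequentially_continuous => u_ u u_u.
by apply: BB; exact: weakstar_cvg_of_norm.
Qed.

Lemma weakstar_cvg_unique (u_ : nat -> dual X) (u v : dual X) :
  weakstar_cvg u_ u -> weakstar_cvg u_ v -> u = v.
Proof.
move=> uu uv; apply: blin_ext => x; have := uv x; have := uu x.
exact: cvg_unique.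
Qed.

Lemma blin_sumE (I : Type) (r : seq I) (f : I -> blin X W) x :
  (\sum_(i <- r) f i) x = \sum_(i <- r) f i x.
Proof. by elim/big_ind2 : _ => // ? ? ? ? <- <-. Qed.

End Operators.

(** * The constraint as a map into continuous functions *)

Section ContinuousFunctionSpace.
Context {R : realType} {T : topologicalType} {W : normedModType R}
  (cT : compact [set: T]).

Lemma to_contE (f : T -> W) : continuous f -> to_cont cT f =1 f.
Proof.
move=> cf x; rewrite /to_cont -[LHS]/(val (insubd 0 _) x) insubdK//.
exact/asboolP.
Qed.

Lemma cont_ext (f g : cont W cT) : f =1 g -> f = g.
Proof. by move=> fg; apply/val_inj/funext. Qed.

Lemma cont_le (f : cont W cT) x : `|f x| <= `|f|.
Proof. exact: sup_norm_ub. Qed.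

Lemma cont_norm_le (f : cont W cT) M : 0 <= M -> (forall x, `|f x| <= M) ->
  `|f| <= M.
Proof. exact: sup_norm_le. Qed.

End ContinuousFunctionSpace.

Section ConstraintMap.
Context {R : realType} {V W : normedModType R} {Y : completeNormedModType R}
  {Y0 : normedModType R} {T : topologicalType} (cT : compact [set: T]).
Variables (iota : {linear Y -> Y0}) (B : blin V W) (G0 : W -> T -> Y0).
Hypotheses (iota_inj : injective iota) (iota_continuous : continuous iota).
Hypothesis G0_range : forall u x, range iota (G0 (B u) x).
Variables (U0 : set V) (W0 : set W).
Hypotheses (U0_open : open U0) (B_U0_W0 : B @` U0 `<=` W0).
Hypothesis G0_diff : forall x w, W0 w -> differentiable (G0 ^~ x) w.
Hypothesis G_continuous : {within B @` U0 `*` [set: T],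
  continuous (fun p : W * T => constraint iota G0 p.1 p.2)}.
Variable DG : W * T -> blin W Y.
Hypothesis DGE : forall w x h, (B @` U0) w ->
  iota (DG (w, x) h) = fderiv (G0 ^~ x) w h.
Hypothesis DG_continuous : {within B @` U0 `*` [set: T], continuous DG}.

Local Notation g := (constraint iota G0).
Local Notation calG := (constraint_map cT B iota G0).

Lemma iota_constraint u x : iota (g (B u) x) = G0 (B u) x.
Proof.
rewrite /constraint /preim_of; case: xgetP => [y -> //|nE].
by have [y _ yE] := G0_range u x; have := nE y.
Qed.

Lemma within_slice {Z : normedModType R} (f : W * T -> Z) w :
  {within B @` U0 `*` [set: T], continuous f} -> (B @` U0) w ->
  continuous (fun x => f (w, x)).
Proof.
move=> /subspace_continuousP cf Uw x; apply/cvgrPdist_lt => e e0.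
have := cf (w, x) (conj Uw I) => /cvgrPdist_lt /(_ e e0) [[A C] /= [Aw Cx] AC].
apply: filterS Cx => y Cy; apply: (AC (w, y)) => /=.
  by split => //=; exact: nbhs_singleton.
by split.
Qed.

Lemma constraint_mapE u : U0 u -> calG u =1 g (B u).
Proof.
move=> Uu x; apply: to_contE.
by apply: (within_slice (f := fun p => g p.1 p.2)) => //; exists u.
Qed.

(** [G0] is differentiable in the norm of [Y0] only, so the mean value inequality
    does not apply in [Y]; [increment_in_subspace] replaces it, with [DG] along
    the segment as the candidate derivative. *)
Lemma constraint_increment u h x e :
  (forall t : R, 0 <= t <= 1 -> U0 (u + t *: h)) ->
  (forall t : R, 0 <= t <= 1 ->
    `|DG (B (u + t *: h), x) (B h) - DG (B u, x) (B h)| <= e) ->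
  `|g (B (u + h)) x - g (B u) x - DG (B u, x) (B h)| <= e.
Proof.
move=> Uh DGe.
pose c (t : R) := DG (B (u + t *: h), x) (B h).
pose phi (t : R) := G0 (B (u + t *: h)) x.
have BU t : 0 <= t <= 1 -> (B @` U0) (B (u + t *: h)).
  by move=> t01; exists (u + t *: h) => //; exact: Uh.
have Bt (s t : R) : B (u + t *: h) = B (u + s *: h) + (t - s) *: B h.
  by rewrite -linearZ -linearD -addrA -scalerDl addrCA subrr addr0.
apply: (increment_in_subspace (c := c) (phi := phi) iota_inj iota_continuous) => //.
- apply: unit_interval_uniform => t e' t01 e'0.
  have e''0 : 0 < e' / (`|B h| + 1) by rewrite divr_gt0// ltr_wpDl.
  have /subspace_continuousP/(_ (B (u + t *: h), x) (conj (BU t t01) I)) := DG_continuous.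
  move=> /cvgrPdist_le /(_ _ e''0) [[A C] /= [Aw Cx] AC].
  have cB : {for t, continuous (fun s : R => B (u + s *: h))}.
    apply: (@continuous_comp _ _ _ (fun s : R => u + s *: h) B); last exact: blin_continuous.
    by apply: cvgD; [exact: cvg_cst|apply: cvgZr_tmp; exact: cvg_id].
  have cBA : \forall s \near t, A (B (u + s *: h)) by exact: cB.
  apply: filterS cBA => s As s01.
  have := AC (B (u + s *: h), x) (conj As (nbhs_singleton Cx)) (conj (BU s s01) I).
  move=> DGs; rewrite /c distrC.
  apply: (le_trans (blin_le (DG (B (u + t *: h), x) - DG (B (u + s *: h), x)) (B h))).
  apply: (@le_trans _ _ (e' / (`|B h| + 1) * (`|B h| + 1))).
    by apply: ler_pM => //; rewrite lerDl.
  by rewrite divfK// gt_eqF// ltr_wpDl.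
- move=> s t d s0 st t1 cd; rewrite /phi (Bt s t) /c.
  have q01 (q : R) : 0 <= q <= 1 -> s <= s + q * (t - s) <= t.
    move=> /andP[q0 q1]; rewrite lerDl mulr_ge0 ?subr_ge0//=.
    by rewrite -lerBrDl ler_piMl ?subr_ge0.
  have q01' (q : R) : s <= q <= t -> 0 <= q <= 1.
    by move=> /andP[sq qt]; rewrite (le_trans s0 sq) (le_trans qt).
  have Bq (q : R) : B (u + s *: h) + q *: ((t - s) *: B h) =
      B (u + (s + q * (t - s)) *: h).
    by rewrite (Bt s (s + _)) [_ + q * _]addrC addrK scalerA.
  have s01 : 0 <= s <= 1 by apply: q01'; rewrite lexx.
  have -> : (t - s) *: iota (DG (B (u + s *: h), x) (B h)) =
      fderiv (G0 ^~ x) (B (u + s *: h)) ((t - s) *: B h).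
    by rewrite linearZ/= -DGE//; exact: BU.
  apply: (mean_value_ineqB (g := G0 ^~ x)) => q q0; rewrite Bq.
    by apply: G0_diff; apply: B_U0_W0; apply: BU; exact/q01'/q01.
  have fZ (f : blin W Y0) z : f ((t - s) *: z) = (t - s) *: f z by rewrite linearZ.
  rewrite !fZ -scalerBr normrZ ger0_norm ?subr_ge0// mulrC ler_wpM2r ?subr_ge0//.
  rewrite -!DGE; [exact/cd/q01|exact: BU|by apply: BU; exact/q01'/q01].
- by rewrite linearB !iota_constraint /phi scale1r scale0r addr0.
Qed.

Lemma DG_slice u : U0 u -> continuous (fun x => DG (B u, x)).
Proof. by move=> Uu; apply: (within_slice (f := DG)) => //; exists u. Qed.

Lemma DG_apply_continuous u z : U0 u -> continuous (fun x => DG (B u, x) z).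
Proof.
move=> Uu x; apply: (@continuous_comp _ _ _ (fun x => DG (B u, x)) (fun f => f z)).
  exact: DG_slice.
exact: (@blin_eval_continuous _ W Y).
Qed.

Lemma constraint_deriv_subproof u : U0 u ->
  (fun h => to_cont cT (fun x => DG (B u, x) (B h))) \in @blin_pred R V (cont Y cT).
Proof.
move=> Uu.
have E h := to_contE cT (@DG_apply_continuous u (B h) Uu).
apply: (blin_predI (M := `|to_cont cT (fun x => DG (B u, x))| * `|B|)).
  move=> a h k; apply: cont_ext => x; rewrite E/= linearP linearP.
  by rewrite -[RHS]/(a *: to_cont cT _ x + to_cont cT _ x) !E.
move=> h; apply: cont_norm_le => [|x]; first by rewrite !mulr_ge0.
rewrite E (le_trans (blin_le _ _))// -mulrA ler_pM ?blin_le//.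
by have := cont_le (to_cont cT (fun x => DG (B u, x))) x; rewrite (to_contE cT (@DG_slice u Uu)).
Qed.

(** The derivative of the constraint map acts pointwise in the parameter: the
    increments are estimated uniformly in it by [constraint_increment] and
    [compact_parameter_uniform]. *)
Lemma constraint_map_deriv u : U0 u -> differentiable calG u /\
  forall h x, fderiv calG u h x = DG (B u, x) (B h).
Proof.
move=> Uu; pose D := Blin (constraint_deriv_subproof Uu).
have DE h x : D h x = DG (B u, x) (B h).
  by rewrite /D/= (to_contE cT (@DG_apply_continuous u (B h) Uu)).
suff H : forall e, 0 < e ->
    \forall h \near 0, `|calG (u + h) - calG u - D h| <= e * `|h|.
  by have [? ->] := fderiv_unique H.
move=> e e0.
have e'0 : 0 < e / (`|B| + 1) by rewrite divr_gt0// ltr_wpDl.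
have tube := compact_parameter_uniform cT DG_continuous (imageP B Uu) e'0.
have nU : nbhs u U0 by apply: open_nbhs_nbhs.
have nB : nbhs u (B @^-1` [set w | (B @` U0) w ->
    forall x, `|DG (w, x) - DG (B u, x)| <= e / (`|B| + 1)]).
  by apply: blin_continuous; exact: tube.
have := near_segment nB; have := near_segment nU.
apply: filterS2 => h hU hB; apply: cont_norm_le => [|x].
  by rewrite mulr_ge0// ltW.
have Uh : U0 (u + h) by have := hU 1; rewrite scale1r lexx ler01; apply.
rewrite -[X in `|X|]/(calG (u + h) x - calG u x - D h x) DE !constraint_mapE//.
apply: constraint_increment => // t t01.
apply: (le_trans (blin_le (DG (B (u + t *: h), x) - DG (B u, x)) (B h))).
apply: (@le_trans _ _ (e / (`|B| + 1) * ((`|B| + 1) * `|h|))).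
  apply: ler_pM => //; first by apply: hB => //; exists (u + t *: h) => //; exact: hU.
  by rewrite (le_trans (blin_le _ _))// ler_wpM2r// lerDl.
by rewrite mulrA divfK// gt_eqF// ltr_wpDl.
Qed.

Lemma constraint_map_cvg (u_ : nat -> V) (u : V) :
  (forall n, U0 (u_ n)) -> U0 u -> B (u_ n) @[n --> \oo] --> B u ->
  calG (u_ n) @[n --> \oo] --> calG u.
Proof.
move=> Uu_ Uu Bu; apply/cvgrPdist_le => e e0.
have tube := compact_parameter_uniform cT G_continuous (imageP B Uu) e0.
have : \forall n \near \oo, (B @` U0) (B (u_ n)) ->
    forall x, `|g (B (u_ n)) x - g (B u) x| <= e by exact: (Bu _ tube).
apply: filterS => n /(_ (imageP B (Uu_ n))) H.
apply: cont_norm_le => [|x]; first exact: ltW.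
by rewrite -[X in `|X|]/(calG u x - calG (u_ n) x) !constraint_mapE// distrC.
Qed.

Lemma constraint_deriv_cvg (u_ : nat -> V) (u : V) (h_ : nat -> V) (h : V) :
  (forall n, U0 (u_ n)) -> U0 u -> B (u_ n) @[n --> \oo] --> B u ->
  B (h_ n) @[n --> \oo] --> B h ->
  fderiv calG (u_ n) (h_ n) @[n --> \oo] --> fderiv calG u h.
Proof.
move=> Uu_ Uu Bu Bh; apply/cvgrPdist_le => e e0.
pose M := `|to_cont cT (fun x => DG (B u, x))|.
have M0 : 0 <= M by exact: normr_ge0.
pose k := `|B h| + 1; have k0 : 0 < k by rewrite /k ltr_wpDl.
have a0 : 0 < e / 2 / k by rewrite !divr_gt0.
have b0 : 0 < e / 2 / (M + 1) by rewrite !divr_gt0// ltr_wpDl.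
have tube := compact_parameter_uniform cT DG_continuous (imageP B Uu) a0.
have near1 : \forall n \near \oo, (B @` U0) (B (u_ n)) ->
    forall x, `|DG (B (u_ n), x) - DG (B u, x)| <= e / 2 / k by exact: (Bu _ tube).
move/cvgrPdist_le : (Bh) => /(_ _ b0) near2.
move/cvgrPdist_le : (Bh) => /(_ _ ltr01) near3.
apply: filterS3 near1 near2 near3 => n /(_ (imageP B (Uu_ n))) H1 H2 H3.
apply: cont_norm_le => [|x]; first exact: ltW.
rewrite -[X in `|X|]/(fderiv calG u h x - fderiv calG (u_ n) (h_ n) x).
rewrite (constraint_map_deriv Uu).2 (constraint_map_deriv (Uu_ n)).2.
rewrite [e]splitr (le_trans (ler_distD (DG (B u, x) (B (h_ n))) _ _))// lerD//.
  rewrite -linearB (le_trans (blin_le _ _))//.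
  apply: (@le_trans _ _ ((M + 1) * (e / 2 / (M + 1)))).
    apply: ler_pM => //; rewrite /M.
    have := cont_le (to_cont cT (fun x => DG (B u, x))) x.
    by rewrite (to_contE cT (@DG_slice u Uu)) => /le_trans; apply; rewrite lerDl.
  by rewrite mulrC divfK// gt_eqF// ltr_wpDl.
apply: (le_trans (blin_le (DG (B u, x) - DG (B (u_ n), x)) (B (h_ n)))).
apply: (@le_trans _ _ (e / 2 / k * k)); last by rewrite divfK// gt_eqF.
apply: ler_pM => //; first by rewrite distrC; exact: H1.
rewrite /k -[X in `|X|](subrK (B h)) (le_trans (ler_normD _ _))// addrC lerD2l.
by rewrite distrC.
Qed.

End ConstraintMap.

(** * Expected and empirical costs *)

Section LawMeasurableFunctions.
Context (R : realType) d (Omega : measurableType d) (P : probability Omega R).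
Context (Xi : ptopologicalType) (xi : {mfun Omega >-> borel Xi}).
Local Notation mu := (law P xi).
Local Notation Xi' := (completion mu).

Lemma law_measurable_realP (f : Xi -> R) :
  law_measurable mu f <-> measurable_fun (setT : set Xi') f.
Proof.
split; first exact: law_measurable_real.
move=> mf _ A mA; apply: mf => //.
by move: A mA; apply: smallest_sub; [exact: sigma_algebra_measurable|exact: open_measurable].
Qed.

Lemma law_measurable_comp (T T' : ptopologicalType) (f : T -> T') (g : Xi -> T) :
  continuous f -> law_measurable mu g -> law_measurable mu (f \o g).
Proof.
move=> cf mg.
have mf : measurable_fun (setT : set (borel T)) (f : borel T -> borel T').
  apply: (@measurability _ _ (borel T) (borel T') setT f (@open T')) => // _ [A oA <-]; rewrite setTI.
  apply: sub_sigma_algebra; move/continuousP : cf; exact.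
exact: (measurableT_comp mf mg).
Qed.

Lemma completed_borel (A : set (borel Xi)) :
  measurable A -> measurable (A : set Xi').
Proof.
move=> mA; apply: sub_sigma_algebra; exists A => //.
rewrite setDv setU0; exact: negligible_set0.
Qed.

(** The section at [w] of the random closed epigraph is obtained from the balls
    around [(w, t)] that the epigraph meets. *)
Lemma random_lsc_section (W : normedModType R) (J : W -> Xi -> R) w :
  random_lsc mu J -> law_measurable mu (J w).
Proof.
move=> [Scl Sm]; apply/law_measurable_realP.
apply: (measurability _ (RGenOInfty.measurableE R)).
move=> _ [_ [t ->] <-]; rewrite setTI.
rewrite (_ : _ @^-1` _ = ~` [set x | J w x <= t]); last first.
  by apply/seteqP; split => x /=; rewrite in_itv/= andbT ltNge => /negP.
apply: measurableC.
rewrite (_ : [set x | J w x <= t] = \bigcap_n [set x |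
  [set p : W * R | J p.1 x <= p.2] `&` (ball (w, t) n.+1%:R^-1 : set (W * R)) !=set0]).
  apply: bigcapT_measurable => n; apply: Sm; exact: ball_open.
apply/seteqP; split => x /=.
  by move=> Jt n _; exists (w, t); split => //; exact: ballxx.
move=> H; apply: (Scl x (w, t)) => O /nbhs_ballP[e /= e0 eO].
have [n _ /(_ n (leqnn n)) ne] := near_infty_natSinv_lt (PosNum e0).
have [p [Jp bp]] := H n I; exists p; split => //.
by apply: eO; apply: le_ball bp; exact: ltW.
Qed.

End LawMeasurableFunctions.

Section Cost.
Context (R : realType) d (Omega : measurableType d) (P : probability Omega R).
Hypothesis P_complete : measure_is_complete P.
Context (Xi : ptopologicalType) (xi : {mfun Omega >-> borel Xi}).
Local Notation mu := (law P xi).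
Variable sample : nat -> {mfun Omega >-> borel Xi}.
Hypothesis sample_law : forall i A, measurable A -> law P (sample i) A = law P xi A.
Hypothesis sample_indep :
  independent_sequence P (fun i => sample i : Omega -> borel Xi).
Context (W : normedModType R).
Variables (J : W -> Xi -> R) (W0 : set W) (L : Xi -> R).
Hypotheses (J_lsc : random_lsc mu J) (W0_open : open W0).
Hypothesis J_C1 : forall x, C1_on W0 (J ^~ x : W -> R^o).
Hypothesis DJ_measurable : forall w, W0 w ->
  law_measurable mu (fun x => fderiv (J ^~ x : W -> R^o) w).
Hypotheses (L_ge0 : forall x, 0 <= L x) (L_measurable : law_measurable mu L).
Hypothesis L_integrable : P.-integrable [set: Omega] (fun w => (L (xi w))%:E).
Hypothesis DJ_bound : forall w x, W0 w -> `|fderiv (J ^~ x : W -> R^o) w| <= L x.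

Local Notation DJ w x := (fderiv (J ^~ x : W -> R^o) w).

Let J_diff w x : W0 w -> differentiable (J ^~ x : W -> R^o) w.
Proof. by move=> W0w; have [/(_ w)] := J_C1 x; rewrite inE => /(_ W0w). Qed.

Lemma DJ_le w x z : W0 w -> `|DJ w x z : R| <= L x * `|z|.
Proof.
move=> W0w; apply: (le_trans (blin_le _ _)); rewrite ler_wpM2r//; exact: DJ_bound.
Qed.

Lemma DJ_cvg w x z e : W0 w -> 0 < e ->
  \forall v \near w, `|(DJ w x z : R) - DJ v x z| <= e.
Proof.
move=> W0w e0; have [_ /(_ w)] := J_C1 x; rewrite inE => /(_ W0w) cD.
have : {for w, continuous (fun v => DJ v x z : R)}.
  apply: (@continuous_comp _ _ _ (fun v => DJ v x) (fun f => f z : R)) => //.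
  exact: (@blin_eval_continuous _ W R^o).
by move/cvgrPdist_le => /(_ _ e0).
Qed.

Lemma DJ_law_measurable w z : W0 w -> law_measurable mu (fun x => DJ w x z : R).
Proof.
move=> W0w; pose ev (f : blin W R^o) : R := f z.
apply: (@law_measurable_comp _ _ _ _ _ _ _ _ ev (fun x => DJ w x)); last exact: DJ_measurable.
exact: (@blin_eval_continuous _ W R^o).
Qed.

Lemma integrable_dominated (f : Xi -> R) c : law_measurable mu f ->
  (forall x, `|f x| <= L x * c) ->
  P.-integrable setT (fun w => (f (xi w))%:E).
Proof.
move=> mf fL; apply: (@le_integrable _ _ _ P _ measurableT _ (fun w => (c%:E * (L (xi w))%:E)%E)).
- by apply/measurable_EFinP; exact: (measurable_fun_sample P_complete (@law_of_xi_id _ _ _ _ _ _) mf).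
- move=> w _; rewrite -EFinM/= lee_fin (le_trans (fL _))//.
  by rewrite mulrC ler_norm.
- exact: integrableZl.
Qed.

Lemma DJ_integrable w z : W0 w -> P.-integrable setT (fun o => (DJ w (xi o) z)%:E).
Proof.
move=> W0w; apply: (integrable_dominated (f := fun x => DJ w x z) (c := `|z|)).
  exact: DJ_law_measurable.
by move=> x; exact: DJ_le.
Qed.

Definition mean_DJ w (z : W) : R := \int[P]_o DJ w (xi o) z.

Lemma mean_DJ_le w z : W0 w -> `|mean_DJ w z| <= \int[P]_o L (xi o) * `|z|.
Proof.
move=> W0w; apply: (le_trans (le_normr_Rintegral _ _)) => //.
  exact: DJ_integrable.
have iLz : P.-integrable setT (fun o => (L (xi o) * `|z|)%:E).
  by under eq_fun do rewrite EFinM muleC; exact: integrableZl.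
rewrite -RintegralZr//.
apply: le_Rintegral => //.
  exact: (integrable_abse (DJ_integrable z W0w)).
by move=> o _; exact: DJ_le.
Qed.

Lemma mean_DJ_blin w : W0 w ->
  exists D : dual W, forall z, D z = mean_DJ w z.
Proof.
move=> W0w.
have lin : (mean_DJ w : W -> R^o) \in @blin_pred R W R^o.
  apply: (blin_predI (M := \int[P]_o L (xi o))).
    move=> a z z'; rewrite /mean_DJ -[RHS]/(a * _ + _).
    rewrite -RintegralZl//; last exact: DJ_integrable.
    rewrite -RintegralD//; last 2 first.
    - exact: (integrableZl measurableT a (DJ_integrable z W0w)).
    - exact: DJ_integrable.
    by apply: eq_Rintegral => o _; rewrite linearP.
  by move=> z; exact: mean_DJ_le.
by exists (Blin lin).
Qed.

Lemma dominated_Rintegral_cvg (f_ : nat -> Omega -> R) (f g : Omega -> R) :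
  (forall n, measurable_fun setT (f_ n)) ->
  (forall o, f_ n o @[n --> \oo] --> f o) ->
  P.-integrable setT (EFin \o g) -> (forall n o, `|f_ n o| <= g o) ->
  \int[P]_o f_ n o @[n --> \oo] --> \int[P]_o f o.
Proof.
move=> mf ff ig fg.
have mf' : measurable_fun setT f := measurable_fun_cvg mf (fun o _ => ff o).
have if_ : P.-integrable setT (EFin \o f).
  apply: le_integrable ig => //; first exact/measurable_EFinP.
  move=> o _; rewrite /= lee_fin; apply: (le_trans _ (ler_norm _)).
  apply: (ler_cvg_to (cvg_norm (ff o)) (cvg_cst (g o))).
  by apply: nearW => n; exact: fg.
apply: fine_cvg; rewrite fineK; last exact: integrable_fin_num.
apply: (@dominated_cvg _ _ _ P setT measurableT _ _ (EFin \o g)) => //.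
- by move=> n; exact/measurable_EFinP.
- by move=> o _; apply: cvg_EFin; [exact: nearW|exact: ff].
- by move=> n o _; rewrite /= lee_fin.
Qed.

Section ExpectedCost.
Context (V : normedModType R) (B : blin V W) (U0 : set V).
Hypotheses (U0_open : open U0) (B_U0_W0 : B @` U0 `<=` W0).

Lemma cost_increment u h x : (forall t : R, 0 <= t <= 1 -> U0 (u + t *: h)) ->
  `|J (B (u + h)) x - J (B u) x| <= L x * `|B h|.
Proof.
move=> Uh; rewrite linearD.
have BU t : 0 <= t <= 1 -> W0 (B u + t *: B h).
  by move=> t01; apply: B_U0_W0; exists (u + t *: h); rewrite ?linearP ?linearD ?linearZ//; exact: Uh.
apply: (mean_value_ineq (g := J ^~ x : W -> R^o)) => t t01.
  by apply: J_diff; exact: BU.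
by apply: DJ_le; exact: BU.
Qed.

Lemma measurable_cost w : measurable_fun setT (fun o => J w (xi o)).
Proof.
exact: (measurable_fun_sample P_complete (@law_of_xi_id _ _ _ _ _ _)
  (random_lsc_section w J_lsc)).
Qed.

Lemma integrable_cost_step u h :
  (forall t : R, 0 <= t <= 1 -> U0 (u + t *: h)) ->
  P.-integrable setT (fun o => (J (B u) (xi o))%:E) ->
  P.-integrable setT (fun o => (J (B (u + h)) (xi o))%:E).
Proof.
move=> Uh iJ.
have iD : P.-integrable setT (fun o => ((J (B (u + h)) (xi o) - J (B u) (xi o))%:E)).
  apply: (@le_integrable _ _ _ P _ measurableT _ (fun o => (`|B h|%:E * (L (xi o))%:E)%E)).
  - by apply/measurable_EFinP; apply: measurable_funB; exact: measurable_cost.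
  - move=> o _; rewrite -EFinM/= lee_fin (le_trans (cost_increment _ Uh))//.
    by rewrite mulrC ler_norm.
  - exact: integrableZl.
have := integrableD measurableT iD iJ.
by apply: eq_integrable => // o _; rewrite /= -EFinD subrK.
Qed.

Local Notation F := (fun u => fine (expected_cost P xi B J u) : R^o).

Let FE u : F u = \int[P]_o J (B u) (xi o).
Proof. by rewrite /expected_cost expectationE. Qed.

(** The difference quotients converge pointwise by differentiability, and are
    dominated by a multiple of [L], so the expectation may be differentiated. *)
Lemma expected_cost_deriv u : U0 u ->
  P.-integrable setT (fun o => (J (B u) (xi o))%:E) ->
  differentiable F u /\ forall h, fderiv F u h = mean_DJ (B u) (B h) :> R.
Proof.
move=> Uu iJ; have W0u : W0 (B u) by apply: B_U0_W0; exists u.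
have [m mE] := mean_DJ_blin W0u; pose D := adjoint B m.
suff H : forall e, 0 < e -> \forall h \near 0, `|F (u + h) - F u - D h| <= e * `|h|.
  have [? ->] := @fderiv_unique _ V R^o (fun u => fine (expected_cost P xi B J u)) u D H.
  by split => // h; exact: mE.
move=> e e0.
have nU : nbhs u U0 by apply: open_nbhs_nbhs.
suff : \forall h \near 0, (forall t : R, 0 <= t <= 1 -> U0 (u + t *: h)) ->
    `|F (u + h) - F u - D h| <= e * `|h|.
  by apply: filterS2 (near_segment nU) => h Uh; apply.
apply: near_seq => h_ h_0; apply: contrapT => /forallNP nE.
have Uh n : forall t : R, 0 <= t <= 1 -> U0 (u + t *: h_ n).
  by have /not_implyP[] := nE n.
have nlt n : e * `|h_ n| < `|F (u + h_ n) - F u - D (h_ n)|.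
  by have /not_implyP[_ /negP] := nE n; rewrite -ltNge.
have h_neq0 n : 0 < `|h_ n|.
  rewrite normr_gt0; apply/eqP => h0; have := nlt n.
  by rewrite h0 addr0 subrr linear0 subr0 !normr0 mulr0 ltxx.
pose q n o : R := `|h_ n|^-1 *
  (J (B (u + h_ n)) (xi o) - J (B u) (xi o) - DJ (B u) (xi o) (B (h_ n))).
have iJn n := integrable_cost_step (Uh n) iJ.
have iDn n := DJ_integrable (B (h_ n)) W0u.
have iJJ n : P.-integrable setT (fun o => (J (B (u + h_ n)) (xi o) - J (B u) (xi o))%:E).
  exact: (integrableB measurableT (iJn n) iJ).
have qE n : \int[P]_o q n o = `|h_ n|^-1 * (F (u + h_ n) - F u - D (h_ n)).
  rewrite RintegralZl//; last exact: (integrableB measurableT (iJJ n) (iDn n)).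
  rewrite (RintegralB _ (iJJ n) (iDn n))// (RintegralB _ (iJn n) iJ)//.
  by congr (_ * (_ - _ - _)); [exact/esym/FE|exact/esym/FE|rewrite /D/= mE].
have : \int[P]_o q n o @[n --> \oo] --> \int[P]_(o in setT) (cst 0 o : R).
  apply: (dominated_Rintegral_cvg (g := fun o => 2 * `|B| * L (xi o))).
  - move=> n; apply: measurable_funM => //; apply: measurable_funB.
      by apply: measurable_funB; exact: measurable_cost.
    by have /measurable_int/measurable_EFinP := iDn n.
  - move=> o; apply/cvgrPdist_le => t t0.
    have t'0 : 0 < t / (`|B| + 1) by rewrite divr_gt0// ltr_wpDl.
    have Hd := differentiable_eps (J_diff (xi o) W0u) t'0.
    have h_cvg : h_ @ \oo --> (0 : V) by exact: cvg_of_rate.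
    have Bh : B (h_ n) @[n --> \oo] --> (0 : W).
      rewrite -(linear0 B); apply: continuous_cvg => //; exact: blin_continuous.
    have : \forall n \near \oo, `|(J (B u + B (h_ n)) (xi o) : R^o) - J (B u) (xi o) -
        DJ (B u) (xi o) (B (h_ n))| <= t / (`|B| + 1) * `|B (h_ n)| by exact: (Bh _ Hd).
    apply: filterS => n Hn; rewrite sub0r normrN /q normrM normfV normr_id.
    rewrite ler_pdivrMl// linearD; apply: (le_trans Hn).
    apply: (@le_trans _ _ (t / (`|B| + 1) * ((`|B| + 1) * `|h_ n|))).
      by rewrite ler_pM2l// (le_trans (blin_le _ _))// ler_wpM2r// lerDl.
    by rewrite mulrA divfK ?gt_eqF// ?ltr_wpDl// mulrC.
  - exact: (integrableZl measurableT (2 * `|B|) L_integrable).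
  - move=> n o; rewrite /q normrM normfV normr_id ler_pdivrMl//.
    apply: (le_trans (ler_normB _ _)).
    apply: (@le_trans _ _ (L (xi o) * `|B (h_ n)| + L (xi o) * `|B (h_ n)|)).
      by rewrite lerD ?cost_increment ?DJ_le//; exact: Uh.
    have := ler_wpM2l (L_ge0 (xi o)) (blin_le B (h_ n)); lra.
rewrite Rintegral_cst// mul0r => /cvgrPdist_lt/(_ e e0)[n _ /(_ n (leqnn n))] /=.
rewrite sub0r normrN qE normrM normfV normr_id ltr_pdivrMl// mulrC => H.
by have := lt_trans (nlt n) H; rewrite ltxx.
Qed.

Lemma sample_cost_deriv (x : nat -> Xi) N u : U0 u ->
  differentiable (sample_cost x B J N) u /\
  forall h, fderiv (sample_cost x B J N) u h =
    N%:R^-1 * \sum_(i < N) DJ (B u) (x i) (B h) :> R.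
Proof.
move=> Uu; have W0u : W0 (B u) by apply: B_U0_W0; exists u.
pose D : dual V := N%:R^-1 *: \sum_(i < N) adjoint B (DJ (B u) (x i)).
have DE h : D h = N%:R^-1 * \sum_(i < N) DJ (B u) (x i) (B h) :> R.
  by rewrite -[LHS]/(N%:R^-1 * (\sum_(i < N) adjoint B (DJ (B u) (x i))) h : R) blin_sumE.
suff H : forall e, 0 < e ->
    \forall h \near 0, `|sample_cost x B J N (u + h) - sample_cost x B J N u - D h| <= e * `|h|.
  by have [? ->] := fderiv_unique H.
move=> e e0.
have e'0 : 0 < e / (`|B| + 1) by rewrite divr_gt0// ltr_wpDl.
have : \forall h \near 0, forall i : 'I_N, `|(J (B u + B h) (x i) : R^o) - J (B u) (x i) -
    DJ (B u) (x i) (B h)| <= e / (`|B| + 1) * `|B h|.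
  apply: filter_forall => i.
  have Hd := differentiable_eps (J_diff (x i) W0u) e'0.
  have cB : B h @[h --> (0 : V)] --> (0 : W).
    by rewrite -[X in _ --> X](linear0 B); exact: blin_continuous.
  exact: (cB _ Hd).
apply: filterS => h Hh.
have -> : sample_cost x B J N (u + h) - sample_cost x B J N u - D h =
    N%:R^-1 * \sum_(i < N) (J (B u + B h) (x i) - J (B u) (x i) - DJ (B u) (x i) (B h)) :> R.
  by rewrite DE /sample_cost linearD -!mulrBr !sumrB.
rewrite normrM normfV (ger0_norm (ler0n _ N)).
have [->|N0] := eqVneq N 0%N; first by rewrite invr0 mul0r mulr_ge0// ltW.
rewrite ler_pdivrMl ?ltr0n ?lt0n//.
apply: (le_trans (ler_norm_sum _ _ _)).
apply: (@le_trans _ _ (\sum_(i < N) e * `|h|)).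
  apply: ler_sum => i _; apply: (le_trans (Hh i)).
  apply: (@le_trans _ _ (e / (`|B| + 1) * ((`|B| + 1) * `|h|))).
    by rewrite ler_pM2l// (le_trans (blin_le _ _))// ler_wpM2r// lerDl.
  by rewrite mulrA divfK ?gt_eqF// ltr_wpDl.
by rewrite sumr_const card_ord mulr_natl.
Qed.

End ExpectedCost.

(** Upper envelopes of the derivative over the points of a dense sequence that
    lie in a ball: one law of large numbers for each of these countably many
    functions yields a law of large numbers that is locally uniform. *)
Section Envelope.
Variables (s : nat -> W) (z : W).
Hypothesis s_dense : forall (w : W) e, 0 < e -> exists n, `|s n - w| < e.

(* the value outside the ball is a lower bound of all the derivatives, hence
   does not contribute to the supremum unless no point qualifies *)
Let a (c : W) (r : R) (n : nat) (x : Xi) : R :=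
  if `[< `|s n - c| < r /\ W0 (s n) >] then DJ (s n) x z else - (L x * `|z|).

Definition envelope (c : W) (r : R) (x : Xi) : R := sups (fun n => a c r n x) 0.

Let a_le c r n x : `|a c r n x| <= L x * `|z|.
Proof.
rewrite /a; case: asboolP => [[_ W0s]|_]; first exact: DJ_le.
by rewrite normrN ger0_norm// mulr_ge0.
Qed.

Let a_ub c r x : has_ubound (range (fun n => a c r n x)).
Proof.
exists (L x * `|z|) => _ [n _ <-]; exact: le_trans (ler_norm _) (a_le _ _ _ _).
Qed.

Let envelopeE c r x : envelope c r x = sup (range (fun n => a c r n x)).
Proof. by congr sup; apply/seteqP; split => _ [n _ <-]; exists n. Qed.

Let a_le_envelope c r n x : a c r n x <= envelope c r x.
Proof. by rewrite envelopeE; apply: ub_le_sup; [exact: a_ub|exists n]. Qed.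

Let envelope_le c r x k : (forall n, a c r n x <= k) -> envelope c r x <= k.
Proof.
move=> ak; rewrite envelopeE; apply: ge_sup; first by exists (a c r 0%N x), 0%N.
by move=> _ [n _ <-].
Qed.

Lemma envelope_bound c r x : `|envelope c r x| <= L x * `|z|.
Proof.
rewrite ler_norml; apply/andP; split.
  apply: le_trans (a_le_envelope c r 0 x).
  by have := a_le c r 0 x; rewrite ler_norml => /andP[].
by apply: envelope_le => n; exact: le_trans (ler_norm _) (a_le _ _ _ _).
Qed.

Lemma envelope_measurable c r : law_measurable mu (envelope c r).
Proof.
apply/law_measurable_realP; apply: measurable_fun_sups => [x _|n]; first exact: a_ub.
rewrite /a; case: asboolP => [[_ W0s]|_].
  exact: (law_measurable_real (DJ_law_measurable z W0s)).
apply: measurableT_comp => //; apply: measurable_funM => //.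
exact/law_measurable_realP.
Qed.

(** By continuity of the derivative, the dense sequence sees all points of the
    ball. *)
Lemma DJ_le_envelope c r x w : W0 w -> `|w - c| < r -> DJ w x z <= envelope c r x.
Proof.
move=> W0w wc; apply/ler_addgt0Pr => e e0.
have : \forall v \near w, [/\ `|(DJ w x z : R) - DJ v x z| <= e, W0 v & `|v - c| < r].
  near=> v; split; near: v; first exact: DJ_cvg.
    exact: open_nbhs_nbhs.
  have rc : 0 < r - `|w - c| by rewrite subr_gt0.
  apply/nbhs_ballP; exists (r - `|w - c|) => // v; rewrite -ball_normE /= => wv.
  rewrite (le_lt_trans (ler_distD w _ _))// distrC -ltrBrDr//.
move=> /nbhs_ballP[t /= t0 Ht]; have [n sn] := s_dense w t0.
have [Dn W0n cn] := Ht (s n) (ltac:(by rewrite -ball_normE /= distrC)).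
have := a_le_envelope c r n x; rewrite /a; case: asboolP => [_|]; last by case.
move=> H; rewrite addrC -lerBlDl; apply: le_trans H.
by rewrite lerBlDr -lerBlDl; exact: le_trans (ler_norm _) Dn.
Unshelve. all: by end_near. Qed.

(** Again by continuity of the derivative, the envelopes of balls that shrink to
    [w] tend to the derivative at [w]. *)
Lemma envelope_near x w e : W0 w -> 0 < e -> exists2 t : R, 0 < t &
  forall r c, r < t -> `|w - c| < r -> `|envelope c r x - DJ w x z| <= e.
Proof.
move=> W0w e0; have [t /= t0 Ht] := (nbhs_ballP _ _).1 (DJ_cvg x z W0w e0).
exists (t / 2); first by rewrite divr_gt0.
move=> r c rt wc.
rewrite ler_norml; apply/andP; split.
  by rewrite lerBrDl (le_trans _ (DJ_le_envelope x W0w wc))// gerDl oppr_le0 ltW.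
rewrite lerBlDr; apply: envelope_le => n; rewrite /a.
case: asboolP => [[sc W0s]|_].
  have : `|(DJ w x z : R) - DJ (s n) x z| <= e.
    apply: Ht; rewrite -ball_normE /=.
    rewrite (le_lt_trans (ler_distD c _ _))// [t]splitr ltrD//.
      exact: lt_trans rt.
    by rewrite distrC (lt_trans sc).
  by rewrite distrC => /(le_trans (ler_norm _)); rewrite lerBlDr.
have := DJ_le x z W0w; rewrite ler_norml => /andP[H _]; apply: (le_trans H).
by rewrite lerDr ltW.
Qed.

Lemma envelope_mean_cvg w (c_ : nat -> W) : W0 w ->
  (forall m, `|w - c_ m| < m.+1%:R^-1) ->
  \int[P]_o envelope (c_ m) m.+1%:R^-1 (xi o) @[m --> \oo] --> mean_DJ w z.
Proof.
move=> W0w wc; apply: (dominated_Rintegral_cvg (g := fun o => L (xi o) * `|z|)).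
- move=> m.
  exact: (measurable_fun_sample P_complete (@law_of_xi_id _ _ _ _ _ _)
    (envelope_measurable _ _)).
- move=> o; apply/cvgrPdist_le => e e0.
  have [t t0 Ht] := envelope_near (xi o) W0w e0.
  have := near_infty_natSinv_lt (PosNum t0).
  by apply: filterS => m /= mt; rewrite distrC; exact: Ht.
- exact: (integrableZr measurableT `|z| L_integrable).
- by move=> m o; exact: envelope_bound.
Qed.

Lemma empirical_upper : {ae P, forall o, forall (w : W) (w_ : nat -> W), W0 w ->
  w_ @ \oo --> w -> forall e, 0 < e -> \forall N \near \oo,
  N%:R^-1 * \sum_(i < N) DJ (w_ N) (sample i o) z <= mean_DJ w z + e}.
Proof.
have : {ae P, forall o, forall j m,
    N%:R^-1 * \sum_(i < N) envelope (s j) m.+1%:R^-1 (sample i o) @[N --> \oo]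
    --> \int[P]_o envelope (s j) m.+1%:R^-1 (xi o)}.
  apply: ae_foralln => j; apply: ae_foralln => m.
  have := @strong_law_sample _ _ _ P P_complete _ _ _ sample_law sample_indep
    _ (envelope_measurable (s j) m.+1%:R^-1).
  rewrite expectationE; apply.
  apply: (integrable_dominated (c := `|z|)); first exact: envelope_measurable.
  by move=> x; exact: envelope_bound.
apply: filterS => o H w w_ W0w w_w e e0.
have e20 : 0 < e / 2 by rewrite divr_gt0.
have /choice[j jP] m : exists j, `|w - s j| < m.+1%:R^-1.
  by have [j jw] := s_dense w (ltac:(by rewrite invr_gt0) : 0 < m.+1%:R^-1);
     exists j; rewrite distrC.
have /cvgrPdist_lt/(_ _ e20)[m _ /(_ m (leqnn m)) Hm] :=
  envelope_mean_cvg (c_ := fun m => s (j m)) W0w jP.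
have near1 := H (j m) m; move/cvgrPdist_lt : near1 => /(_ _ e20) near1.
have near2 : \forall v \near w, `|v - s (j m)| < m.+1%:R^-1 /\ W0 v.
  near=> v; split; near: v; last exact: open_nbhs_nbhs.
  have rc : 0 < m.+1%:R^-1 - `|w - s (j m)| by rewrite subr_gt0.
  apply/nbhs_ballP; exists (m.+1%:R^-1 - `|w - s (j m)|) => // v.
  rewrite -ball_normE /= => wv.
  by rewrite (le_lt_trans (ler_distD w _ _))// distrC -ltrBrDr.
have near2' : \forall N \near \oo, `|w_ N - s (j m)| < m.+1%:R^-1 /\ W0 (w_ N) := w_w _ near2.
apply: filterS2 near1 near2' => N H1 [H2 H3].
apply: (@le_trans _ _ (N%:R^-1 * \sum_(i < N) envelope (s (j m)) m.+1%:R^-1 (sample i o))).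
  rewrite ler_wpM2l ?invr_ge0//; apply: ler_sum => i _; exact: DJ_le_envelope.
move: H1 Hm; rewrite !ltr_norml => /andP[H1 _] /andP[H4 _].
lra.
Unshelve. all: by end_near. Qed.

End Envelope.

(** The points depend on the sample, hence the need for a uniform law. Upper bounds
    in the directions [z] and [- z] give convergence for the countably many [z] of
    a dense sequence; other directions follow because the empirical derivatives
    are Lipschitz with the averages of [L], which converge, as constants. *)
Lemma empirical_deriv_cvg : separable W -> {ae P, forall o,
  forall (w h : W) (w_ h_ : nat -> W), W0 w -> w_ @ \oo --> w -> h_ @ \oo --> h ->
  N%:R^-1 * \sum_(i < N) DJ (w_ N) (sample i o) (h_ N) @[N --> \oo] --> mean_DJ w h}.
Proof.
move=> /dense_sequence_norm[s s_dense].
have U z := empirical_upper z s_dense.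
have LL := @strong_law_sample _ _ _ P P_complete _ _ _ sample_law sample_indep
  _ L_measurable L_integrable.
have UN := ae_foralln (fun k => U (- s k)).
have {}U := ae_foralln (fun k => U (s k)).
apply: filterS3 U UN LL => o U UN; rewrite expectationE -/(Rintegral _ _ _) => LL.
move=> w h w_ h_ W0w w_w h_h; apply/cvgrPdist_le => e e0.
pose M := \int[P]_o L (xi o) + 1.
have IL0 : 0 <= \int[P]_o L (xi o) by apply: Rintegral_ge0 => x _.
have M0 : 0 < M by rewrite /M ltr_wpDl.
have n0 : 0 < e / (4 * M) by rewrite divr_gt0// mulr_gt0.
have e40 : 0 < e / 4 by rewrite divr_gt0.
have [k sk] := s_dense h _ n0.
have near1 := U k w w_ W0w w_w _ e40.
have near2 := UN k w w_ W0w w_w _ e40.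
move/cvgrPdist_le : LL => /(_ _ ltr01) near3.
move/cvgrPdist_le : h_h => /(_ _ n0) near4.
have near5 : \forall N \near \oo, W0 (w_ N).
  by apply: w_w; exact: open_nbhs_nbhs.
pose AA N z := N%:R^-1 * \sum_(i < N) (DJ (w_ N) (sample i o) z : R).
near=> N.
have W0N : W0 (w_ N) by near: N.
have H1 : AA N (s k) <= mean_DJ w (s k) + e / 4 by near: N; exact: near1.
have H2 : AA N (- s k) <= mean_DJ w (- s k) + e / 4 by near: N; exact: near2.
pose A := AA N; rewrite -/(A (s k)) in H1; rewrite -/(A (- s k)) in H2.
have AB z z' : `|A z - A z'| <= M * `|z - z'|.
  rewrite /A /AA -mulrBr -sumrB normrM normfV (ger0_norm (ler0n _ N)).
  apply: (@le_trans _ _ (N%:R^-1 * \sum_(i < N) (L (sample i o) * `|z - z'|))).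
    rewrite ler_wpM2l ?invr_ge0//; apply: (le_trans (ler_norm_sum _ _ _)).
    by apply: ler_sum => i _; rewrite -linearB; exact: DJ_le.
  rewrite -mulr_suml mulrA ler_wpM2r//.
  have : `|\int[P]_o L (xi o) - N%:R^-1 * \sum_(i < N) L (sample i o)| <= 1.
    by near: N; exact: near3.
  rewrite ler_norml => /andP[H _]; rewrite /M; lra.
have mB : `|mean_DJ w (s k) - mean_DJ w h| <= M * `|s k - h|.
  have [D DE] := mean_DJ_blin W0w.
  have -> : mean_DJ w (s k) - mean_DJ w h = mean_DJ w (s k - h) by rewrite -!DE linearB.
  by apply: (le_trans (mean_DJ_le _ W0w)); rewrite ler_wpM2r// lerDl.
have mN : mean_DJ w (- s k) = - mean_DJ w (s k).
  by have [D DE] := mean_DJ_blin W0w; rewrite -!DE linearN.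
have AN : A (- s k) = - A (s k).
  by rewrite /A /AA -mulrN -sumrN; congr (_ * _); apply: eq_bigr => i _; rewrite linearN.
have H4 : `|h - h_ N| <= e / (4 * M) by near: N; exact: near4.
rewrite -[X in mean_DJ w h - X]/(A (h_ N)).
have H5 : `|h_ N - s k| <= e / (4 * M) + e / (4 * M).
  rewrite (le_trans (ler_distD h _ _))// lerD//; first by rewrite distrC.
  by rewrite distrC ltW.
have H6 : `|A (h_ N) - A (s k)| <= e / 2.
  apply: (le_trans (AB _ _)); apply: (@le_trans _ _ (M * (e / (4 * M) + e / (4 * M)))).
    by rewrite ler_pM2l.
  by rewrite le_eqVlt; apply/orP; left; apply/eqP; field; rewrite gt_eqF.
have H7 : `|mean_DJ w (s k) - mean_DJ w h| <= e / 4.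
  apply: (le_trans mB); apply: (@le_trans _ _ (M * (e / (4 * M)))).
    by rewrite ler_pM2l// ltW.
  by rewrite le_eqVlt; apply/orP; left; apply/eqP; field; rewrite gt_eqF.
rewrite mN AN in H2.
move: H6 H7; rewrite !ler_norml => /andP[? ?] /andP[? ?]; apply/andP; split; lra.
Unshelve. all: by end_near. Qed.

End Cost.

Section EmpiricalFrequencies.
Context (R : realType) d (Omega : measurableType d) (P : probability Omega R).
Hypothesis P_complete : measure_is_complete P.
Context (Xi : completeMetricType R) (xi : {mfun Omega >-> borel Xi}).
Local Notation mu := (law P xi).
Variable sample : nat -> {mfun Omega >-> borel Xi}.
Hypothesis sample_law : forall i A, measurable A -> law P (sample i) A = law P xi A.
Hypothesis sample_indep :
  independent_sequence P (fun i => sample i : Omega -> borel Xi).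
Hypotheses (Xi_separable : separable Xi) (Xi_support : law_support mu = [set: Xi]).

Lemma support_open_gt0 (O : set Xi) : open O -> O !=set0 -> (0 < mu O)%E.
Proof.
move=> oO [x Ox]; rewrite lt_neqAle measure_ge0 andbT; apply/negP => /eqP O0.
have mO : measurable (O : set (borel Xi)) by exact: sub_sigma_algebra.
have : law_support mu x by rewrite Xi_support.
move=> /(_ (~` O)) []//; split; first exact: open_closedC.
by rewrite probability_setC// -O0 sube0.
Qed.

(** Every neighborhood contains a member of a countable base, whose frequency
    tends to its probability. *)
Lemma empirical_frequency : {ae P, forall o, forall (x : Xi) (A : set Xi),
  nbhs x A -> exists2 t : R, 0 < t & \forall N \near \oo,
    t <= N%:R^-1 * \sum_(i < N) \1_A (sample i o)}.
Proof.
have [s sP] := dense_sequence Xi_separable.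
pose O j m : set Xi := (ball (s j) m.+1%:R^-1)°.
have oO j m : open (O j m) by exact: open_interior.
have : {ae P, forall o, forall j m,
    N%:R^-1 * \sum_(i < N) (\1_(O j m) (sample i o) : R) @[N --> \oo]
    --> fine (mu (O j m))}.
  apply: ae_foralln => j; apply: ae_foralln => m.
  have mO : measurable (O j m : set (borel Xi)) by exact: sub_sigma_algebra.
  have lO : law_measurable mu (\1_(O j m) : Xi -> R).
    by apply/law_measurable_realP; apply: measurable_indic; exact: completed_borel.
  have mxO : measurable (xi @^-1` O j m).
    by rewrite -[X in measurable X]setTI; exact: measurable_funPT.
  have := @strong_law_sample _ _ _ P P_complete _ _ _ sample_law sample_indep _ lO.
  rewrite (_ : \1_(O j m) \o xi = \1_(xi @^-1` O j m)); last first.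
    by apply/funext => o; rewrite /= !indicE.
  rewrite expectation_indic//; apply.
  by apply: eq_integrable (integrable_indic P mxO).
apply: filterS => o H x A /nbhs_ballP[r /= r0 rA].
have r20 : 0 < r / 2 by rewrite divr_gt0.
have [m _ /(_ m (leqnn m)) /= mr] := near_infty_natSinv_lt (PosNum r20).
have [||j xj] := sP (ball x m.+1%:R^-1)°; first exact: open_interior.
  by exists x; apply: nbhsx_ballx; rewrite invr_gt0.
have OA : O j m `<=` A.
  move=> y /interior_subset jy; apply: rA.
  apply: (@le_ball _ _ x (m.+1%:R^-1 + m.+1%:R^-1)); first by rewrite [leRHS]splitr lerD// ltW.
  by apply: ball_triangle jy; exact: interior_subset.
have O0 : (0 < mu (O j m))%E.
  by apply: support_open_gt0 => //; exists (s j); apply: nbhsx_ballx; rewrite invr_gt0.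
have f0 : 0 < fine (mu (O j m)) by rewrite fine_gt0// O0 ltey_eq fin_num_measure//; exact: sub_sigma_algebra.
exists (fine (mu (O j m)) / 2); first by rewrite divr_gt0.
have := H j m => /cvgrPdist_lt/(_ (fine (mu (O j m)) / 2)).
rewrite divr_gt0// => /(_ isT); apply: filterS => N.
rewrite ltr_norml => /andP[_ HN].
apply: (@le_trans _ _ (N%:R^-1 * \sum_(i < N) (\1_(O j m) (sample i o) : R))); first by lra.
rewrite ler_wpM2l ?invr_ge0//; apply: ler_sum => i _.
rewrite !indicE ler_nat; case: (boolP (_ \in O j m)) => // /set_mem/OA/mem_set.
by move=> ->.
Qed.

End EmpiricalFrequencies.

(** * Penalty functions of cones *)

Section Penalty.
Context {R : realType} {Y : normedModType R}.

Lemma closed_cone0 (K : set Y) : K !=set0 -> closed K -> cone K -> K 0.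
Proof.
move=> [k Kk] cK Kcone; apply: cK => O O0.
have : (t *: k) @[t --> (0 : R)] --> (0 : Y).
  by rewrite -[X in _ --> X](scale0r k); apply: cvgZr_tmp; exact: cvg_id.
move=> /(_ _ O0) /nbhs_ballP[r /= r0 rO].
have r20 : 0 < r / 2 by rewrite divr_gt0.
exists ((r / 2) *: k); split; first exact: Kcone.
apply: (rO (r / 2)); rewrite /ball/= sub0r normrN gtr0_norm//.
by rewrite ltr_pdivrMr// ltr_pMr// ltr1n.
Qed.

Variable beta : Y -> R^o.
Hypothesis beta_convex : convex_function [set: Y] beta.
Hypothesis beta_diff : forall r, differentiable beta r.

Lemma convex_gradient_ineq (r s : Y) :
  (fderiv beta r (s - r) : R) <= beta s - beta r.
Proof.
set h := s - r; apply/ler_addgt0Pr => e e0.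
have e'0 : 0 < e / (`|h| + 1) by rewrite divr_gt0// ltr_wpDl.
have /nbhs_ballP[d /= d0 Hd] := differentiable_eps (beta_diff r) e'0.
pose t : R := Num.min 1 (d / 2 / (`|h| + 1)).
have t0 : 0 < t by rewrite lt_min ltr01 !divr_gt0// ltr_wpDl.
have t1 : t <= 1 by rewrite ge_min lexx.
have th : `|t *: h| < d.
  rewrite normrZ gtr0_norm//; apply: (@le_lt_trans _ _ (d / 2)); last first.
    by rewrite ltr_pdivrMr// ltr_pMr// ltr1n.
  apply: (@le_trans _ _ (t * (`|h| + 1))); first by rewrite ler_pM2l// lerDl.
  by rewrite -ler_pdivlMr ?ltr_wpDl// ge_min lexx orbT.
have := Hd (t *: h); rewrite -ball_normE /= sub0r normrN => /(_ th).
rewrite linearZ/= normrZ (gtr0_norm t0) => H1.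
have H2 : beta (r + t *: h) <= t * beta s + (1 - t) * beta r.
  have := beta_convex (Itv01 (ltW t0) t1) (in_setT s) (in_setT r).
  rewrite /conv/= => H2; apply: le_trans H2.
  rewrite le_eqVlt; apply/orP; left; apply/eqP; congr beta.
  by rewrite /h /unstable.onem scalerBr scalerBl scale1r addrCA.
have H3 : e / (`|h| + 1) * (t * `|h|) <= t * e.
  rewrite mulrCA ler_pM2l// mulrAC ler_pdivrMr ?ltr_wpDl//.
  by rewrite ler_pM2l// lerDl.
have H4 : t * (fderiv beta r h : R) <= t * (beta s - beta r + e).
  move: H1; rewrite ler_norml => /andP[H1 _].
  have : - (e / (`|h| + 1) * (t * `|h|)) <= beta (r + t *: h) - beta r - t * (fderiv beta r h : R) by exact: H1.
  nra.
by rewrite -(ler_pM2l t0).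
Qed.

Variable K : set Y.
Hypotheses (K0 : K 0) (K_cone : cone K).
Hypotheses (beta_ge0 : forall r, 0 <= beta r) (beta_eq0 : forall r, beta r = 0 <-> K r).

(** Otherwise the gradient inequality at the multiples of [k], where the penalty
    vanishes, would fail for a large multiple. *)
Lemma penalty_deriv_le0 r k : K k -> (fderiv beta r k : R) <= 0.
Proof.
move=> Kk; rewrite leNgt; apply/negP => Dk.
have H s : 0 < s -> s * (fderiv beta r k : R) <= (fderiv beta r r : R).
  move=> s0; have := convex_gradient_ineq r (s *: k).
  rewrite (beta_eq0 _).2; last exact: K_cone.
  rewrite linearB linearZ/= -[s *: _]/(s * _) sub0r => H.
  by rewrite -subr_le0; apply: (le_trans H); rewrite oppr_le0.
pose q : R := fderiv beta r r.
have := H ((`|q| + 1) / (fderiv beta r k : R)).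
rewrite divr_gt0 ?ltr_wpDl// => /(_ isT); rewrite divfK ?gt_eqF//.
rewrite -/q => H'; have := le_lt_trans (ler_norm q) (ltr_pwDr ltr01 (lexx `|q|)).
by rewrite ltNge H'.
Qed.

(** The gradient inequality at the origin, where the penalty vanishes. *)
Lemma penalty_deriv_ge r : beta r <= (fderiv beta r r : R).
Proof.
have := convex_gradient_ineq r 0; rewrite (beta_eq0 _).2// sub0r linearN sub0r.
by rewrite lerN2.
Qed.

End Penalty.

(** * Limits of multipliers *)

Section Multipliers.
Context {R : realType} {Z : normedModType R}.

Lemma bounded_weakstar_pairing (l_ : nat -> dual Z) (l : dual Z) (z_ : nat -> Z) z M :
  (\forall n \near \oo, `|l_ n| <= M) -> weakstar_cvg l_ l ->
  z_ @ \oo --> z -> (l_ n (z_ n) : R) @[n --> \oo] --> (l z : R).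
Proof.
move=> lM ll zz; apply/cvgrPdist_le => e e0.
have e20 : 0 < e / 2 by rewrite divr_gt0.
have e'0 : 0 < e / 2 / (`|M| + 1) by rewrite !divr_gt0// ltr_wpDl.
have near1 := ll z; move/cvgrPdist_le : near1 => /(_ _ e20) near1.
move/cvgrPdist_le : zz => /(_ _ e'0) near2.
apply: filterS3 lM near1 near2 => n H1 H2 H3.
rewrite [e]splitr (le_trans (ler_distD (l_ n z : R) _ _))// lerD//.
rewrite -linearB; apply: (le_trans (blin_le _ _)).
apply: (@le_trans _ _ ((`|M| + 1) * (e / 2 / (`|M| + 1)))).
  by apply: ler_pM => //; rewrite (le_trans H1)// (le_trans (ler_norm M))// lerDl.
by rewrite mulrC divfK// gt_eqF// ltr_wpDl.
Qed.

(** A Slater point leaves room for a ball inside the cone; functionals that are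
    nonpositive on the cone and not too negative at the Slater point are then
    bounded on that ball. *)
Lemma slater_multiplier_bounded (K : set Z) (l_ : nat -> dual Z) (z_ : nat -> Z) z C :
  (forall n, polar K (l_ n)) -> z_ @ \oo --> z -> K° z ->
  (\forall n \near \oo, - C <= (l_ n (z_ n) : R)) ->
  exists M, \forall n \near \oo, `|l_ n| <= M.
Proof.
move=> lK zz /nbhs_ballP[r /= r0 rK] lC.
have r20 : 0 < r / 2 by rewrite divr_gt0.
exists (C / (r / 2)).
move/cvgrPdist_lt : zz => /(_ _ r20) near1.
apply: filterS2 near1 lC => n H1 H2.
have H v : `|v| <= 1 -> (l_ n v : R) <= C / (r / 2).
  move=> v1; rewrite ler_pdivlMr// mulrC.
  have Kv : K (z_ n + (r / 2) *: v).
    apply: rK; rewrite -ball_normE /= opprD addrA (le_lt_trans (ler_normB _ _))//.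
    rewrite [r in ltRHS]splitr ltr_leD// normrZ gtr0_norm//.
    by rewrite -[leRHS]mulr1 ler_pM2l.
  have := lK n _ Kv; rewrite linearD linearZ/= -[(r / 2) *: _]/((r / 2) * _) => H3.
  have : (l_ n (z_ n) : R) + (r / 2) * (l_ n v : R) <= 0 by exact: H3.
  by lra.
apply: op_norm_le => v v1; rewrite ler_norml H// andbT lerNl.
by have := H (- v); rewrite normrN linearN; apply.
Qed.

End Multipliers.

(** The values [p n] stand on the smaller side of the inequality, so that lower
    semicontinuity is all that is needed of them. *)
Lemma subgradient_ineq_limit {R : realType} (p : nat -> \bar R) (pu pv : \bar R)
    (r_ : nat -> R) (r : R) :
  (0 <= pv)%E -> (pu <= limn_einf p)%E ->
  (forall n, (p n <= pv + (r_ n)%:E)%E) -> r_ @ \oo --> r ->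
  (pu <= pv + r%:E)%E.
Proof.
move=> pv0 pup pn rr; apply: (le_trans pup); rewrite limn_einf_lim.
have cv : (fun n => (pv + (r_ n)%:E)%E) @ \oo --> (pv + r%:E)%E.
  case: pv pv0 {pn} => [q| |]// _.
    by under eq_fun do rewrite -EFinD; apply: cvg_EFin; [exact: nearW|apply: cvgD => //; exact: cvg_cst].
  by rewrite addye//; under eq_fun do rewrite addye//; exact: cvg_cst.
rewrite -(cvg_lim _ cv)//; apply: lee_lim.
- exact: is_cvg_einfs.
- by apply/cvg_ex; eexists; exact: cv.
- by apply: nearW => n; apply: le_trans (pn n); apply: ereal_inf_lbound; exists n => /=.
Qed.

Section StationaryLimit.
Context {R : realType} {V Z : normedModType R}.
Variables (psi : V -> \bar R) (F_ : nat -> V -> R^o) (F : V -> R^o) (G : V -> Z).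
Variables (K : set Z) (u_ : nat -> V) (u : V) (l_ : nat -> dual Z) (l : dual Z).
Hypothesis psi_ge0 : forall v, (0 <= psi v)%E.
Hypothesis psi_lim : (psi u <= limn_einf (fun n => psi (u_ n)))%E.
Hypothesis u_stationary : forall n, stationary (F_ n) psi G (u_ n) (l_ n).
Hypothesis F_cvg : forall v,
  (fderiv (F_ n) (u_ n) (v - u_ n) : R) @[n --> \oo] --> (fderiv F u (v - u) : R).
Hypothesis G_cvg : G (u_ n) @[n --> \oo] --> G u.
Hypothesis DG_cvg : forall v,
  fderiv G (u_ n) (v - u_ n) @[n --> \oo] --> fderiv G u (v - u).
Hypothesis l_polar : forall n, polar K (l_ n).
Hypothesis l_G_ge0 : forall n, 0 <= (l_ n (G (u_ n)) : R).
Hypothesis l_cvg : weakstar_cvg l_ l.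
Hypothesis slater : exists2 v, edom psi v & K° (G u + fderiv G u (v - u)).

Let stationary_ineq n v : (psi (u_ n) <= psi v +
  ((fderiv (F_ n) (u_ n) (v - u_ n) : R) +
   (l_ n (fderiv G (u_ n) (v - u_ n)) : R))%:E)%E.
Proof.
have [eta [ufin sub] E] := u_stationary n.
set a : R := fderiv (F_ n) _ _; set b : R := l_ n _.
have {E} : a + (eta (v - u_ n) : R) + b = 0.
  by have := congr1 (fun f : dual V => f (v - u_ n) : R) E.
move=> E; have := sub v; have -> : (eta (v - u_ n) : R) = - (a + b) by lra.
by rewrite EFinN leeBlDr.
Qed.

(** Testing stationarity in the Slater direction bounds the multipliers. *)
Lemma stationary_multipliers_bounded : exists M, \forall n \near \oo, `|l_ n| <= M.
Proof.
have [v vdom Kv] := slater.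
pose q := fine (psi v).
have vq : psi v = q%:E.
  by rewrite /q fineK// ge0_fin_numE.
pose a : R := fderiv F u (v - u).
have zz : G (u_ n) + fderiv G (u_ n) (v - u_ n) @[n --> \oo] --> G u + fderiv G u (v - u).
  by apply: cvgD; [exact: G_cvg|exact: DG_cvg].
apply: (slater_multiplier_bounded l_polar zz Kv (C := q + a + 1)).
have := @F_cvg v; move/cvgrPdist_le => /(_ _ ltr01); apply: filterS => n.
rewrite -/a ler_norml => /andP[H1 H2].
have := le_trans (psi_ge0 (u_ n)) (stationary_ineq n v).
rewrite vq -EFinD lee_fin => H3; rewrite (linearD (l_ n)).
pose b : R := l_ n (G (u_ n)); pose c : R := l_ n (fderiv G (u_ n) (v - u_ n)).
pose f : R := fderiv (F_ n) (u_ n) (v - u_ n).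
have {}H1 : -1 <= a - f by exact: H1.
have {}H3 : 0 <= q + (f + c) by exact: H3.
have b0 : 0 <= b by exact: l_G_ge0.
suff : - (q + a + 1) <= b + c by exact.
by clearbody a b c f; lra.
Qed.

Lemma multiplier_constraint_cvg :
  (l_ n (G (u_ n)) : R) @[n --> \oo] --> (l (G u) : R).
Proof.
have [M lM] := stationary_multipliers_bounded.
exact: (bounded_weakstar_pairing lM l_cvg G_cvg).
Qed.

Lemma polar_limit : polar K l.
Proof.
move=> k Kk; apply: (ler_cvg_to (@l_cvg k) (cvg_cst (0 : R))).
by apply: nearW => n; exact: l_polar.
Qed.

(** Stationarity is equivalent to a variational inequality for all test points.
    In this form it passes to the limit: bounded multipliers make the duality
    pairing continuous, and [psi] is lower semicontinuous. *)
Lemma stationary_limit : stationary F psi G u l.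
Proof.
have [M lM] := stationary_multipliers_bounded.
have ineq v : (psi u <= psi v +
    ((fderiv F u (v - u) : R) + (l (fderiv G u (v - u)) : R))%:E)%E.
  apply: (subgradient_ineq_limit (psi_ge0 v) psi_lim (stationary_ineq ^~ v)).
  apply: cvgD; first exact: F_cvg.
  exact: (bounded_weakstar_pairing lM l_cvg (@DG_cvg v)).
have ufin : psi u \is a fin_num.
  rewrite ge0_fin_numE//; have [v vdom _] := slater.
  by apply: (le_lt_trans (ineq v)); rewrite lte_add_pinfty// ltry.
exists (- (fderiv F u + adjoint (fderiv G u) l)); last by rewrite addrAC subrr.
split=> // v.
rewrite -[X in (_ + X%:E)%E]/(- ((fderiv F u (v - u) : R) + (l (fderiv G u (v - u)) : R))).
by rewrite EFinN leeBlDr.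
Qed.

End StationaryLimit.

(** Points where the limit violates the constraint have a neighborhood on which
    the penalty stays bounded away from zero; it is hit with positive frequency,
    so the averaged penalty could not vanish. *)
Lemma penalized_limit_feasible {R : realType} {T : topologicalType}
    {Y : normedModType R} (cT : compact [set: T]) (beta : Y -> R^o) (K : set Y)
    (x : nat -> T) (k : nat -> nat) (gamma : nat -> R)
    (g_ : nat -> cont Y cT) (g : cont Y cT) (C : R) :
  continuous beta -> (forall r, 0 <= beta r) -> (forall r, beta r = 0 <-> K r) ->
  (forall (y : T) (A : set T), nbhs y A -> exists2 t : R, 0 < t &
    \forall N \near \oo, t <= N%:R^-1 * \sum_(i < N) \1_A (x i)) ->
  {homo k : m n / (m < n)%N} -> gamma @ \oo --> +oo -> g_ @ \oo --> g ->
  (\forall n \near \oo,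
    gamma (k n) * ((k n)%:R^-1 * \sum_(i < k n) beta (g_ n (x i))) <= C) ->
  pointwise_cone cT K g.
Proof.
move=> beta_cont beta_ge0 beta_eq0 freq kk gam gg gC y; apply: contrapT => nK.
pose e := beta (g y) / 2.
have e0 : 0 < e.
  rewrite divr_gt0// lt_neqAle beta_ge0 andbT eq_sym; apply/eqP.
  by move/beta_eq0.
have : \forall z \near g y, `|beta (g y) - beta z| < e.
  by move: (beta_cont (g y)) => /cvgrPdist_lt; apply.
move=> /nbhs_ballP[r /= r0 rbeta].
have r20 : 0 < r / 2 by rewrite divr_gt0.
pose A : set T := [set z | `|g y - g z| < r / 2].
have nA : nbhs y A.
  by move: (@cont_continuous _ _ _ _ g y) => /cvgrPdist_lt; apply.
have [t t0 tN] := freq y A nA.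
have near1 : \forall n \near \oo, t <= (k n)%:R^-1 * \sum_(i < k n) (\1_A (x i) : R).
  exact: (near_subseq kk tN).
have near2 : \forall n \near \oo, `|C| / (e * t) < gamma (k n).
  by have /cvgryPgt/(_ (`|C| / (e * t))) H := gam; exact: (near_subseq kk H).
move/cvgrPdist_lt : gg => /(_ _ r20) near3.
have [n _ /(_ n (leqnn n)) [H1 H2 [H3 H4]]] : \forall n \near \oo,
    [/\ t <= (k n)%:R^-1 * \sum_(i < k n) (\1_A (x i) : R),
      `|C| / (e * t) < gamma (k n) & `|g - g_ n| < r / 2 /\
      gamma (k n) * ((k n)%:R^-1 * \sum_(i < k n) beta (g_ n (x i))) <= C].
  near=> n; split; [near: n|near: n|split; near: n] => //.
have low : e * ((k n)%:R^-1 * \sum_(i < k n) (\1_A (x i) : R)) <=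
    (k n)%:R^-1 * \sum_(i < k n) beta (g_ n (x i)).
  rewrite mulrCA ler_wpM2l ?invr_ge0// mulr_sumr; apply: ler_sum => i _.
  rewrite indicE; case: (boolP (_ \in A)) => [/set_mem Ax|_]; last first.
    by rewrite mulr0; exact: beta_ge0.
  rewrite mulr1; have : `|beta (g y) - beta (g_ n (x i))| < e.
    apply: rbeta; rewrite -ball_normE /= (le_lt_trans (ler_distD (g (x i)) _ _))//.
    rewrite [r]splitr ltrD//; apply: le_lt_trans H3.
    exact: (cont_le (g - g_ n) (x i)).
  rewrite ltr_norml => /andP[_]; have -> : beta (g y) = e + e by rewrite /e -splitr.
  lra.
have et0 : 0 < e * t by rewrite mulr_gt0.
have S : e * t <= (k n)%:R^-1 * \sum_(i < k n) beta (g_ n (x i)).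
  by apply: le_trans low; rewrite ler_pM2l.
have g0 : 0 < gamma (k n) by apply: le_lt_trans H2; rewrite divr_ge0// ltW.
rewrite ltr_pdivrMr// in H2.
have := le_trans (ler_wpM2l (ltW g0) S) H4.
by rewrite leNgt (le_lt_trans (ler_norm C)).
Unshelve. all: by end_near. Qed.

Theorem theorem4p10 (R : realType)
  (* the probability space, the random element xi and the sample *)
  (d : measure_display) (Omega : measurableType d) (P : probability Omega R)
  (P_complete : measure_is_complete P)
  (Xi : completeMetricType R) (Xi_separable : separable Xi)
  (xi : {mfun Omega >-> borel Xi})
  (sample : nat -> {mfun Omega >-> borel Xi})
  (sample_law : forall i A, measurable A -> law P (sample i) A = law P xi A)
  (sample_indep :
    independent_sequence P (fun i => sample i : Omega -> borel Xi))
  (* the Banach spaces; iota is the inclusion of Y in Y0, and U is dual X *)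
  (W Y Y0 X : completeNormedModType R)
  (W_separable : separable W) (Y_separable : separable Y)
  (Y0_separable : separable Y0) (X_separable : separable X)
  (iota : {linear Y -> Y0})
  (iota_inj : injective iota) (iota_continuous : continuous iota)
  (B : {linear dual X -> W})
  (B_continuous : forall (u_ : nat -> dual X) (u : dual X),
    weakstar_cvg u_ u -> B (u_ n) @[n --> \oo] --> B u)
  (J : W -> Xi -> R) (J_ge0 : forall w x, 0 <= J w x)
  (J_lsc : random_lsc (law P xi) J)
  (psi : dual X -> \bar R) (psi_ge0 : forall u, (0 <= psi u)%E)
  (psi_proper : edom psi !=set0) (psi_convex : convex_ereal psi)
  (psi_lsc : forall (u_ : nat -> dual X) (u : dual X),
    weakstar_cvg u_ u -> (psi u <= limn_einf (fun n => psi (u_ n)))%E)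
  (dom_bounded : bounded_set (edom psi))
  (dom_closed : forall (u_ : nat -> dual X) (u : dual X),
    (forall n, edom psi (u_ n)) -> weakstar_cvg u_ u -> edom psi u)
  (G0 : W -> Xi -> Y0)
  (G0_caratheodory : caratheodory_on (law P xi) [set: W] G0)
  (G0_range : forall u x, range iota (G0 (B u) x))
  (G_caratheodory :
    caratheodory_on (law P xi) (B @` edom psi) (constraint iota G0))
  (K : set Y) (K_neq0 : K !=set0) (K_closed : closed K)
  (K_convex : convex_set K) (K_cone : cone K)
  (feasible_point : exists u,
    (expected_cost P xi B J u + psi u < +oo)%E /\
    {ae law P xi, forall x, K (constraint iota G0 (B u) x)})
  (Xi_compact : compact [set: Xi])
  (U0 : set (dual X)) (W0 : set W) (U0_open : open U0) (W0_open : open W0)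
  (dom_U0 : edom psi `<=` U0) (B_U0_W0 : B @` U0 `<=` W0)
  (J_C1 : forall x, C1_on W0 (J ^~ x : W -> R^o))
  (DJ_measurable : forall w, W0 w ->
    law_measurable (law P xi) (fun x => fderiv (J ^~ x : W -> R^o) w))
  (L : Xi -> R) (L_ge0 : forall x, 0 <= L x)
  (L_measurable : law_measurable (law P xi) L)
  (L_integrable : P.-integrable [set: Omega] (fun w => (L (xi w))%:E))
  (DJ_bound : forall w x, W0 w -> `|fderiv (J ^~ x : W -> R^o) w| <= L x)
  (G0_C1 : forall x, C1_on W0 (G0 ^~ x))
  (DG0_measurable : forall w, W0 w ->
    law_measurable (law P xi) (fun x => fderiv (G0 ^~ x) w))
  (G_continuous : {within B @` U0 `*` [set: Xi],
    continuous (fun p : W * Xi => constraint iota G0 p.1 p.2)})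
  (DG_continuous : exists DG : W * Xi -> blin W Y,
    (forall w x h, (B @` U0) w ->
      iota (DG (w, x) h) = fderiv (G0 ^~ x) w h) /\
    {within B @` U0 `*` [set: Xi], continuous DG})
  (* Xi is the support of the law *)
  (Xi_support : law_support (law P xi) = [set: Xi])
  (* the penalty function beta *)
  (beta : Y -> R^o) (beta_ge0 : forall r, 0 <= beta r)
  (beta_convex : convex_function [set: Y] beta)
  (beta_C1 : C1_on [set: Y] beta)
  (beta_eq0 : forall r, beta r = 0 <-> K r)
  (K_interior : (pointwise_cone Xi_compact K)° !=set0)
  (gamma : nat -> R) (gamma_gt0 : forall N, (0 < N)%N -> 0 < gamma N)
  (gamma_cvg : gamma N @[N --> \oo] --> +oo)
  (* the sequence of stationary points of the penalized sample problems *)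
  (u_ : nat -> Omega -> dual X)
  (lambda_ : nat -> Omega -> dual (cont Y Xi_compact))
  (lambda_def : {ae P, forall w, forall N, (0 < N)%N ->
    forall v : cont Y Xi_compact, lambda_ N w v =
      N%:R^-1 * \sum_(i < N) gamma N *
        fderiv beta (constraint iota G0 (B (u_ N w)) (sample i w))
          (v (sample i w))})
  (u_stationary : {ae P, forall w, forall N, (0 < N)%N ->
    stationary (sample_cost (fun i => sample i w) B J N) psi
      (constraint_map Xi_compact B iota G0) (u_ N w) (lambda_ N w)})
  (ubar : Omega -> dual X)
  (u_cvg : {ae P, forall w, weakstar_cvg (fun N => u_ N w) (ubar w)})
  (ubar_regular : {ae P, forall w, exists2 uhat, edom psi uhat &
    (pointwise_cone Xi_compact K)°
      (constraint_map Xi_compact B iota G0 (ubar w) +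
       fderiv (constraint_map Xi_compact B iota G0) (ubar w)
         (uhat - ubar w))}) :
  {ae P, forall w,
    forall (k : nat -> nat) (u : dual X) (lambda : dual (cont Y Xi_compact)),
      {homo k : m n / (m < n)%N} ->
      weakstar_cvg (fun n => u_ (k n) w) u ->
      weakstar_cvg (fun n => lambda_ (k n) w) lambda ->
      KKT_point (fun u => fine (expected_cost P xi B J u)) psi
        (constraint_map Xi_compact B iota G0) (pointwise_cone Xi_compact K)
        u lambda}.
Proof.
(* weak-star to strong continuity makes [B] a bounded operator *)
have B_cont : continuous B := weakstar_to_strong_continuous B_continuous.
have B_blin : (B : dual X -> W) \in @blin_pred R (dual X) W.
  by apply/asboolP; split => // a u v; rewrite linearP.
pose Bb : blin (dual X) W := Blin B_blin.
have [DG [DGE DGc]] := DG_continuous.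
have G0_diff x w : W0 w -> differentiable (G0 ^~ x) w.
  by move=> W0w; have [/(_ w)] := G0_C1 x; rewrite inE => /(_ W0w).
have beta_diff r : differentiable beta r.
  by have [/(_ r)] := beta_C1; rewrite inE => /(_ I).
have K0 := closed_cone0 K_neq0 K_closed K_cone.
pose g w x := constraint iota G0 w x.
pose calG := constraint_map Xi_compact B iota G0.
pose F (u : dual X) : R^o := fine (expected_cost P xi B J u).
have calGE u : U0 u -> forall x, calG u x = g (B u) x.
  move=> Uu x; exact: (constraint_mapE (B := Bb) Xi_compact G_continuous Uu x).
have calG_deriv u (Uu : U0 u) := constraint_map_deriv (B := Bb) Xi_compact
  iota_inj iota_continuous G0_range U0_open B_U0_W0 G0_diff G_continuous DGE DGc Uu.
have psi_seg u v : edom psi u -> edom psi v -> forall t : R, 0 <= t <= 1 ->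
    edom psi (u + t *: (v - u)).
  move=> pu pv t t01; have := psi_convex v u t t01.
  have -> : t *: v + (1 - t) *: u = u + t *: (v - u).
    by rewrite scalerBr scalerBl scale1r addrCA.
  move=> /le_lt_trans; apply.
  have /andP[t0 t1] := t01.
  by apply: lte_add_pinfty; apply: lte_mul_pinfty; rewrite ?lee_fin ?subr_ge0.
(* the expected cost is finite on the whole domain of [psi], starting from the
   feasible point: the derivative of the cost is dominated along segments *)
have iJ u : edom psi u -> P.-integrable setT (fun o => (J (Bb u) (xi o))%:E).
  move=> pu; have [u1 [fin1 _]] := feasible_point.
  have E0 : (0 <= expected_cost P xi B J u1)%E by apply: expectation_ge0 => o.
  have pu1 : edom psi u1.
    apply: le_lt_trans fin1; rewrite -{1}[psi u1]add0e leeD2r//.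
  have E1 : (expected_cost P xi B J u1 < +oo)%E.
    by apply: le_lt_trans fin1; rewrite -{1}[expected_cost _ _ _ _ _]adde0 leeD2l.
  have i1 : P.-integrable setT (fun o => (J (Bb u1) (xi o))%:E).
    apply/integrableP; split.
      by apply/measurable_EFinP; exact: (measurable_cost P_complete J_lsc).
    by under eq_integral do rewrite /= ger0_norm//; rewrite -expectationE.
  rewrite -[u](subrK u1) addrC.
  apply: (integrable_cost_step P_complete J_lsc J_C1 L_integrable DJ_bound (B := Bb)
    B_U0_W0 _ i1).
  move=> t t01; apply: dom_U0; exact: psi_seg.
have F_deriv u (pu : edom psi u) := expected_cost_deriv P_complete J_lsc J_C1
  DJ_measurable L_ge0 L_integrable DJ_bound (B := Bb) U0_open B_U0_W0
  (dom_U0 _ pu) (iJ u pu).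
have LLN := empirical_deriv_cvg P_complete sample_law sample_indep W0_open J_C1
  DJ_measurable L_ge0 L_measurable L_integrable DJ_bound W_separable.
have freq := empirical_frequency P_complete sample_law sample_indep
  Xi_separable Xi_support.
apply: filterS2 (filterI (filterI lambda_def u_stationary) (filterI u_cvg ubar_regular))
  (filterI LLN freq) => o [[lam stat] [ucvg slater]] [{}LLN {}freq].
move=> k u l k_incr u_k l_k.
(* sample sizes start at [1]; the first term of the subsequence is dropped *)
pose m n := k n.+1.
have m_incr : {homo m : i j / (i < j)%N} by move=> i j ij; apply: k_incr.
have m_gt0 n : (0 < m n)%N by rewrite (leq_ltn_trans (leq0n (k n)))// k_incr.
have shift (T : topologicalType) (f : nat -> T) (a : T) :
    f (k n) @[n --> \oo] --> a -> f (m n) @[n --> \oo] --> a.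
  exact: (cvg_subseq (f := f \o k) (k := succn)).
pose v n := u_ (m n) o; pose lm n := lambda_ (m n) o.
have v_cvg : weakstar_cvg v u.
  move=> x; exact: (shift _ (fun n => u_ n o x : R) _ (u_k x)).
have lm_cvg : weakstar_cvg lm l.
  move=> x; exact: (shift _ (fun n => lambda_ n o x : R) _ (l_k x)).
(* the whole sequence converges, so the limit is the point that satisfies the
   Slater condition *)
have uE : u = ubar o.
  apply: (weakstar_cvg_unique v_cvg) => x.
  exact: (cvg_subseq (f := fun n => u_ n o x : R) m_incr (ucvg x)).
have pv n : edom psi (v n).
  have [eta [+ _] _] := stat (m n) (m_gt0 n).
  by rewrite ge0_fin_numE.
have pu : edom psi u := dom_closed _ _ pv v_cvg.
have Uv n : U0 (v n) := dom_U0 _ (pv n).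
have Uu : U0 u := dom_U0 _ pu.
have Bu : B (u_ N o) @[N --> \oo] --> B u by apply: B_continuous; rewrite uE.
have Bv : B (v n) @[n --> \oo] --> B u := B_continuous _ _ v_cvg.
pose F_ n := sample_cost (fun i => sample i o) B J (m n).
have F_cvg w : (fderiv (F_ n) (v n) (w - v n) : R) @[n --> \oo] -->
    (fderiv F u (w - u) : R).
  have Bw : B (w - u_ N o) @[N --> \oo] --> B (w - u).
    under eq_fun do rewrite linearB; rewrite linearB.
    by apply: cvgB => //; exact: cvg_cst.
  have W0u : W0 (B u) by apply: B_U0_W0; exists u.
  have LLNw := cvg_subseq m_incr (LLN _ _ _ _ W0u Bu Bw).
  apply: (cvg_congr _ _ LLNw) => [n|]; last exact: (F_deriv u pu).2.
  exact: (sample_cost_deriv J_C1 (B := Bb) B_U0_W0 _ _ (Uv n)).2.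
have G_cvg : calG (v n) @[n --> \oo] --> calG u.
  exact: (constraint_map_cvg (B := Bb) G_continuous Uv Uu Bv).
have DG_cvg w : fderiv calG (v n) (w - v n) @[n --> \oo] --> fderiv calG u (w - u).
  have Bw : B (w - v n) @[n --> \oo] --> B (w - u).
    under eq_fun do rewrite linearB; rewrite linearB.
    by apply: cvgB => //; exact: cvg_cst.
  exact: (constraint_deriv_cvg (B := Bb) iota_inj iota_continuous G0_range
    U0_open B_U0_W0 G0_diff G_continuous DGE DGc Uv Uu Bv Bw).
have gm_gt0 n : 0 < gamma (m n) by exact: gamma_gt0.
have lm_polar n : polar (pointwise_cone Xi_compact K) (lm n).
  move=> z Kz; rewrite lam// mulr_ge0_le0 ?invr_ge0//.
  apply: sumr_le0 => i _; rewrite mulr_ge0_le0 ?(ltW (gm_gt0 n))//.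
  exact: (penalty_deriv_le0 beta_convex beta_diff K_cone beta_ge0 beta_eq0).
have lm_ge n : gamma (m n) * ((m n)%:R^-1 *
    \sum_(i < m n) beta (calG (v n) (sample i o))) <= (lm n (calG (v n)) : R).
  rewrite lam// mulrCA ler_wpM2l ?invr_ge0// mulr_sumr; apply: ler_sum => i _.
  rewrite ler_pM2l//= -/(v n) (calGE _ (Uv n)).
  exact: (penalty_deriv_ge beta_convex beta_diff K0 beta_eq0).
have lm_ge0 n : 0 <= (lm n (calG (v n)) : R).
  apply: le_trans (lm_ge n); rewrite !mulr_ge0 ?invr_ge0 ?(ltW (gm_gt0 n))//.
  by apply: sumr_ge0 => i _; exact: beta_ge0.
have psi_lim := psi_lsc _ _ v_cvg.
have stat_m n : stationary (F_ n) psi calG (v n) (lm n) by exact: stat.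
have slater_u : exists2 w, edom psi w &
    (pointwise_cone Xi_compact K)° (calG u + fderiv calG u (w - u)).
  by rewrite uE.
have lG := multiplier_constraint_cvg psi_ge0 stat_m F_cvg G_cvg DG_cvg lm_polar
  lm_ge0 lm_cvg slater_u.
have feas : pointwise_cone Xi_compact K (calG u).
  apply: (penalized_limit_feasible (beta := beta) (x := fun i => sample i o)
    (k := m) (gamma := gamma) (g_ := fun n => calG (v n)) (C := (l (calG u) : R) + 1)) => //.
    by move=> r; exact: differentiable_continuous.
  move/cvgrPdist_le : lG => /(_ _ ltr01); apply: filterS => n.
  rewrite ler_norml => /andP[H _]; apply: (le_trans (lm_ge n)).
  by rewrite -lerBlDl -[leRHS]opprK lerNr opprB.
have l_polar := polar_limit lm_polar lm_cvg.
split => //.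
- by split; [exact: (F_deriv u pu).1|exact: (calG_deriv u Uu).1].
- exact: (stationary_limit psi_ge0 psi_lim stat_m F_cvg G_cvg DG_cvg lm_polar
    lm_ge0 lm_cvg slater_u).
- apply/eqP; rewrite eq_le; apply/andP; split; first exact: l_polar.
  apply: (ler_cvg_to (cvg_cst (0 : R)) lG).
  by apply: nearW => n; exact: lm_ge0.
Qed.
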